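(* Let $D_1,D_2\subset\mathbb C^n$ be complete hyperbolic bounded domains, and assume that $D_1$ and $D_2$ have the visibility property. If $(D_1,k_{D_1})$ is Gromov hyperbolic and $D_1$ has no geodesic loops in $\overline{D_1}$, then every biholomorphism $F:D_1\to D_2$ extends continuously to $\partial D_1$ (i.e. extends to a continuous map on $\overline{D_1}$).
   Context: For a domain $D\subset\mathbb C^n$, $k_D$ denotes the Kobayashi (pseudo)distance (the integrated form of the Kobayashi–Royden metric). $D$ is complete hyperbolic if $k_D$ is a complete distance. A geodesic is a curve $\sigma:I\to D$ on an interval $I\subset\mathbb R$ with $k_D(\sigma(s),\sigma(t))=|s-t|$ for all $s,t\in I$; it is a geodesic line if $I=(-\infty,+\infty)$. Closures and boundaries are Euclidean. Visibility: for $D$ complete hyperbolic and $p\neq q$ in $\partial D$, the pair $\{p,q\}$ has visible geodesics if there are neighborhoods $U,V$ of $p,q$ respectively with $\overline U\cap\overline V=\emptyset$ and a compact set $K\subset D$ such that every geodesic $\gamma:[0,L]\to D$ with $\gamma(0)\in U$, $\gamma(L)\in V$ satisfies $\gamma([0,L])\cap K\ne\emptyset$. $D$ has the visibility property if every pair of distinct boundary points has visible geodesics. A geodesic line $\gamma$ in $D$ is a geodesic loop in $\overline D$ if $\gamma$ has the same cluster set in $\overline D$ at $+\infty$ and at $-\infty$; $D$ has no geodesic loops in $\overline D$ if no geodesic line is a geodesic loop in $\overline D$. *)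

(* Defs.v *)
From HB Require Import structures.
From mathcomp Require Import all_boot all_order all_algebra.
From mathcomp Require Import complex.
From mathcomp Require Import all_classical all_reals all_analysis.

Set Implicit Arguments.
Unset Strict Implicit.
Unset Printing Implicit Defensive.

Import Order.TTheory GRing.Theory Num.Theory.
Import numFieldNormedType.Exports.

Local Open Scope classical_set_scope.
Local Open Scope complex_scope.
Local Open Scope ring_scope.

(* The complex numbers with the topology of the modulus; 'rV[R[i]]_n then
   inherits the topology of the sup norm, i.e. the Euclidean one. *)
HB.instance Definition _ (R : realType) := NormedModule.copy R[i] R[i]^o.

Section metric_notions.
Context {R : realType} {T : Type}.
Implicit Types (X : set T) (d : T -> T -> R).

Definition is_distance_on X d : Prop :=
  [/\ forall x y, X x -> X y -> 0 <= d x y,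
      forall x y, X x -> X y -> (d x y = 0 <-> x = y),
      forall x y, X x -> X y -> d x y = d y x &
      forall x y z, X x -> X y -> X z -> d x z <= d x y + d y z].

Definition is_complete_on X d : Prop :=
  forall u : nat -> T, (forall m, X (u m)) ->
    (forall e : R, 0 < e ->
       exists N, forall l m, (N <= l)%N -> (N <= m)%N -> d (u l) (u m) < e) ->
    exists2 x, X x & d (u m) x @[m --> \oo] --> (0 : R).

Definition gromov_product d (o x y : T) : R := (d x o + d y o - d x y) / 2.

Definition gromov_hyperbolic X d : Prop :=
  exists2 delta : R, 0 <= delta &
    forall o x y z, X o -> X x -> X y -> X z ->
      Num.min (gromov_product d o x y) (gromov_product d o y z) - delta
        <= gromov_product d o x z.

End metric_notions.

Definition boundary {T : topologicalType} (D : set T) : set T :=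
  closure D `\` interior D.

Definition is_domain {T : topologicalType} (D : set T) : Prop :=
  [/\ D !=set0, open D & connected D].

(* On an open set, Frechet differentiability over the field R[i] is
   holomorphy. *)
Definition holomorphic_on {R : realType} {V W : normedModType R[i]}
    (D : set V) (f : V -> W) : Prop :=
  forall z, D z -> differentiable f z.

Definition biholomorphism {R : realType} {V W : normedModType R[i]}
    (D1 : set V) (D2 : set W) (F : V -> W) : Prop :=
  holomorphic_on D1 F /\ (forall z, D1 z -> D2 (F z)) /\
  exists G : W -> V,
    [/\ holomorphic_on D2 G, forall w, D2 w -> D1 (G w),
        forall z, D1 z -> G (F z) = z & forall w, D2 w -> F (G w) = w].

Section kobayashi.
Context {R : realType} {n : nat}.
Implicit Types (D : set 'rV[R[i]]_n) (z w v p q : 'rV[R[i]]_n).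
Implicit Types (gamma : R -> 'rV[R[i]]_n).

Definition unit_disc : set R[i] := [set zeta | `|zeta| < 1].

Definition kobayashi_royden D z v : R :=
  inf [set r : R | exists lambda : R[i], exists phi : R[i] -> 'rV[R[i]]_n,
    [/\ holomorphic_on unit_disc phi,
        forall zeta, unit_disc zeta -> D (phi zeta),
        phi 0 = z, lambda *: derive1 phi 0 = v & r%:C = `|lambda|]].

(* Derivatives of curves are in a real variable, whereas 'rV[R[i]]_n is only a
   normed space over R[i]; hence the explicit difference quotients. *)
Definition diff_quotient gamma (t s : R) : 'rV[R[i]]_n :=
  ((s - t)^-1)%:C *: (gamma s - gamma t).

Definition velocity gamma (t : R) : 'rV[R[i]]_n :=
  lim (diff_quotient gamma t s @[s --> t^']).

(* C^1 on the closed segment [a, b], with one-sided derivatives at its ends. *)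
Definition C1_on (a b : R) gamma : Prop :=
  exists2 dgamma : R -> 'rV[R[i]]_n,
    {within `[a, b], continuous dgamma} &
    forall t : R, t \in `[a, b] ->
      diff_quotient gamma t s @[s --> within `[a, b] t^'] --> dgamma t.

Definition piecewise_C1_on (a b : R) gamma : Prop :=
  exists2 s : seq R, itv_partition a b s &
    forall i, (i < size s)%N ->
      C1_on (nth b (a :: s) i) (nth b (a :: s) i.+1) gamma.

(* The finitely many break points, where velocity is a junk value, form a
   null set. *)
Definition kobayashi_length D gamma : \bar R :=
  (\int[lebesgue_measure]_(t in `[0%R, 1%R])
     (kobayashi_royden D (gamma t) (velocity gamma t))%:E)%E.

Definition kobayashi_dist D z w : R :=
  fine (ereal_inf [set kobayashi_length D gamma | gamma in
    [set gamma : R -> 'rV[R[i]]_n |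
      [/\ piecewise_C1_on 0 1 gamma, forall t : R, t \in `[0, 1] -> D (gamma t),
          gamma 0 = z & gamma 1 = w]]]).

Definition complete_hyperbolic D : Prop :=
  is_distance_on D (kobayashi_dist D) /\ is_complete_on D (kobayashi_dist D).

Definition geodesic D (I : set R) gamma : Prop :=
  (forall t, I t -> D (gamma t)) /\
  (forall s t, I s -> I t -> kobayashi_dist D (gamma s) (gamma t) = `|s - t|).

Definition visible_geodesics D p q : Prop :=
  exists U V K : set 'rV[R[i]]_n,
    [/\ nbhs p U, nbhs q V & closure U `&` closure V = set0] /\
    [/\ compact K, K `<=` D &
        forall (L : R) gamma, 0 <= L -> geodesic D `[0, L] gamma ->
          U (gamma 0) -> V (gamma L) -> exists2 t : R, t \in `[0, L] & K (gamma t)].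

Definition visibility_property D : Prop :=
  forall p q, boundary D p -> boundary D q -> p <> q -> visible_geodesics D p q.

Definition geodesic_line D gamma : Prop := geodesic D setT gamma.

Definition geodesic_loop D gamma : Prop :=
  geodesic_line D gamma /\
  closure D `&` cluster (gamma t @[t --> +oo]) =
  closure D `&` cluster (gamma t @[t --> -oo]).

Definition no_geodesic_loops D : Prop := forall gamma, ~ geodesic_loop D gamma.

End kobayashi.

(* Main.v *)
(* A biholomorphism is an isometry of the Kobayashi distances.  If [F] had two
   limits [q <> q'] at a boundary point [p] of [D1], along [z k] and [w k],
   visibility of [D2] would make the geodesics from [F (z k)] to [F (w k)] meet a
   fixed compact set.  Their preimages meet a compact subset of [D1], so that
   they have an ultralimit, a geodesic line of [D1].  By visibility of [D1] this
   line tends to [p] in both directions, i.e. it is a geodesic loop.  So [F] has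
   a limit at every boundary point.

   That geodesics exist and that closed Kobayashi balls are compact is
   Hopf-Rinow for a complete length distance.  That the Kobayashi length is
   invariant rests on holomorphic maps being C^1, which comes from Cauchy's
   estimate on discs and Goursat's theorem. *)
Require Import Defs.
From mathcomp Require Import all_boot all_order all_algebra.
From mathcomp Require Import complex.
From mathcomp Require Import all_classical all_reals all_analysis.
From mathcomp Require Import measurable_realfun ring lra.

Set Implicit Arguments.
Unset Strict Implicit.
Unset Printing Implicit Defensive.

Import Order.TTheory GRing.Theory Num.Theory.
Import numFieldNormedType.Exports.

Local Open Scope classical_set_scope.
Local Open Scope complex_scope.
Local Open Scope ring_scope.

(** * The real-valued norm of a complex normed space *)

(** Admissible curves are piecewise [C^1], so [F \o gamma] is admissible once the differential of
    [F] is continuous, whereas [holomorphic_on] only provides Frechet differentiability. The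
    function theory fills this gap. Circles are handled as vertical edges of rectangles in
    logarithmic coordinates, where bisection applies.

    Measurability of the Kobayashi-Royden metric is left open, so a length is a supremum of
    integrals of simple functions. Such integrals are monotone and superadditive, hence the
    distances between successive points of a curve add up to at most its length; the opposite
    inequality is the triangle inequality contained in [is_distance_on]. These two facts carry the
    metric arguments.

    Limits are taken along one free ultrafilter on [nat]. Every sequence in a compact set converges
    along it, so a sequence of geodesics has limits at all times simultaneously, over the same
    indices. The same ultrafilter serves the limits of [F] and both ends of the limit line, whose
    cluster set at each end is then [p] alone. *)

Section real_norm.
Context {R : realType} {V : normedModType R[i]}.
Implicit Types (v w : V) (e : R).

(** The norm of a normed space over [R[i]] takes its values in [R[i]]. Its real part is the same
    number read in [R], where the order is total and [lra] applies. *)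
Definition nr v : R := complex.Re `|v|.

Lemma nrE v : `|v| = (nr v)%:C.
Proof. by rewrite /nr RRe_real// ger0_real. Qed.

Lemma nr_ge0 v : 0 <= nr v.
Proof. by rewrite -ler0c -nrE. Qed.

Lemma nr0 : nr (0 : V) = 0.
Proof. by rewrite /nr normr0. Qed.

Lemma nr_eq0 v : nr v = 0 -> v = 0.
Proof. by move=> v0; apply: normr0_eq0; rewrite nrE v0. Qed.

Lemma nrN v : nr (- v) = nr v.
Proof. by rewrite /nr normrN. Qed.

Lemma nrB v w : nr (v - w) = nr (w - v).
Proof. by rewrite -nrN opprB. Qed.

Lemma nrD v w : nr (v + w) <= nr v + nr w.
Proof. by rewrite -lecR rmorphD/= -!nrE; exact: ler_normD. Qed.

Lemma nr_triangle u v w : nr (v - w) <= nr (v - u) + nr (u - w).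
Proof. by rewrite -[v - w](subrKA u) nrD. Qed.

Lemma nr_ballE v e w : ball v e%:C w = (nr (v - w) < e).
Proof. by rewrite -ball_normE/= /ball_/= nrE ltcR. Qed.

Lemma nbhs_nrP v (A : set V) :
  nbhs v A <-> exists2 e : R, 0 < e & forall w, nr (w - v) < e -> A w.
Proof.
split=> [/nbhs_ballP[e /= e0 eA]|[e e0 eA]].
  have eE : e = (complex.Re e)%:C by rewrite RRe_real// gtr0_real.
  exists (complex.Re e); first by rewrite -ltcR -eE.
  by move=> w wv; apply: eA; rewrite eE nr_ballE nrB.
apply/nbhs_ballP; exists e%:C; first by rewrite /= ltcR.
by move=> w; rewrite nr_ballE nrB; exact: eA.
Qed.

Lemma cvg_nrP {T : Type} (F : set_system T) {FF : Filter F} (f : T -> V) v :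
  f @ F --> v <-> forall e, 0 < e -> \forall t \near F, nr (f t - v) < e.
Proof.
split=> [fv e e0|fv A /nbhs_nrP[e e0 eA]].
  by apply: (fv [set w | nr (w - v) < e]); apply/nbhs_nrP; exists e.
by rewrite /= /nbhs/=; apply: filterS (fv _ e0) => t /eA.
Qed.

Lemma nbhs_nr v e : 0 < e -> nbhs v [set w | nr (w - v) < e].
Proof. by move=> e0; apply/nbhs_nrP; exists e. Qed.

End real_norm.

Section real_norm_scale.
Context {R : realType} {V : normedModType R[i]}.

Lemma nrZ (c : R[i]) (v : V) : nr (c *: v) = nr c * nr v.
Proof. by apply: complexI; rewrite -nrE normrZ !nrE rmorphM. Qed.

Lemma nr_real (r : R) : nr (r%:C : R[i]) = `|r|.
Proof. by rewrite /nr normc_def /= expr0n/= addr0 sqrtr_sqr. Qed.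

Lemma nrZr (r : R) (v : V) : nr (r%:C *: v) = `|r| * nr v.
Proof. by rewrite nrZ nr_real. Qed.

Lemma nrM (a b : R[i]) : nr (a * b) = nr a * nr b.
Proof. by apply: complexI; rewrite -nrE normrM !nrE rmorphM. Qed.

Lemma nrV (a : R[i]) : nr (a^-1) = (nr a)^-1.
Proof. by apply: complexI; rewrite -nrE normfV !nrE fmorphV. Qed.

Lemma nr_gt0 (v : V) : v != 0 -> 0 < nr v.
Proof. by move=> v0; rewrite -ltcR -nrE normr_gt0. Qed.

Lemma Re_le_nr (a : R[i]) : `|complex.Re a| <= nr a.
Proof. by rewrite -lecR -nrE normc_ge_Re. Qed.

Lemma Im_le_nr (a : R[i]) : `|complex.Im a| <= nr a.
Proof.
rewrite /nr normc_def/= -sqrtr_sqr ler_wsqrtr// lerDr sqr_ge0//.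
Qed.

Lemma nr_le_ReIm (a : R[i]) : nr a <= `|complex.Re a| + `|complex.Im a|.
Proof.
rewrite [a in leLHS]complexE (le_trans (nrD _ _))// nrM !nr_real lerD//.
have -> : nr ('i%C : R[i]) = 1 by rewrite /nr normc_def/= expr0n/= expr1n add0r sqrtr1.
by rewrite mul1r.
Qed.

Lemma diff_nrP (W : normedModType R[i]) (f : V -> W) z : differentiable f z ->
  forall e : R, 0 < e -> exists2 d : R, 0 < d &
    forall h, nr h < d -> nr (f (z + h) - f z - 'd f z h) <= e * nr h.
Proof.
move=> df e e0.
have /eqaddoP/(_ e%:C) := diff_locally df.
rewrite ltcR => /(_ e0) /nbhs_nrP[d d0 dP].
exists d => // h hd; rewrite -lecR rmorphM/= -!nrE.
have := dP h; rewrite subr0 => /(_ hd).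
by rewrite /= !fctE/= opprD addrA [h + z]addrC.
Qed.

End real_norm_scale.

(** * Goursat's theorem and Cauchy's estimate *)

Section primitive.
Context {R : realType}.
Implicit Types (a b : R).

Lemma primitive_continuous (u : R -> R) a b : a < b ->
  (forall x, a <= x <= b -> {for x, continuous u}) ->
  exists U : R -> R, {within `[a, b], continuous U} /\
    forall x, x \in `]a, b[ -> is_derive x 1 U (u x).
Proof.
move=> ab uc.
have iu : lebesgue_measure.-integrable `[a, b] (EFin \o u).
  apply: continuous_compact_integrable; first exact: segment_compact.
  by apply: continuous_in_subspaceT => x; rewrite inE/= in_itv/= => /uc.
exists (fun x => parameterized_integral lebesgue_measure a x u); split.
  by apply: parameterized_integral_continuous => //; exact: ltW.
move=> x; rewrite in_itv/= => /andP[ax xb].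
have ux : {for x, continuous u} by apply: uc; rewrite (ltW ax) (ltW xb).
have [dF F'] := continuous_FTC1_closed xb iu ax ux.
by apply: DeriveDef; [exact: dF|rewrite -derive1E].
Qed.

(** Mean value theorem for [U] minus the quadratic primitive of [A + x * B]. One [U] serves all
    subsegments and all affine functions, as the bisection in Goursat's theorem requires. *)
Lemma primitive_affine_bound (u : R -> R) a b : a < b ->
  (forall x, a <= x <= b -> {for x, continuous u}) ->
  exists U : R -> R, forall c d A B e : R, a <= c -> c <= d -> d <= b ->
    (forall x, c <= x <= d -> `|u x - (A + x * B)| <= e) ->
    `|U d - U c - ((d - c) * A + (d ^+ 2 - c ^+ 2) / 2 * B)| <= e * (d - c).
Proof.
move=> ab uc; have [U [Uc dU]] := primitive_continuous ab uc.
exists U => c d A B e ac cd db ue.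
pose g x := U x - (x * A + x ^+ 2 / 2 * B).
have gE : g d - g c = U d - U c - ((d - c) * A + (d ^+ 2 - c ^+ 2) / 2 * B).
  by rewrite /g; ring.
have dg x : x \in `]c, d[ -> is_derive x 1 g (u x - (A + x * B)).
  rewrite in_itv/= => /andP[cx xd].
  have dUx : is_derive x 1 U (u x).
    by apply: dU; rewrite in_itv/= (le_lt_trans ac)// (lt_le_trans xd).
  have -> : g = U - (fun x => x * A + x ^+ 2 / 2 * B) by [].
  apply: is_deriveB; apply: is_derive_eq.
  by rewrite /GRing.scale/=; field.
have gc : {within `[c, d], continuous g}.
  have Ucd : {within `[c, d], continuous U}.
    apply: continuous_subspaceW Uc => x; rewrite /= !in_itv/= => /andP[cx xd].
    by rewrite (le_trans ac)//= (le_trans xd).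
  have -> : g = U - (fun x => x * A + x ^+ 2 / 2 * B) by [].
  move=> x; apply: continuousD _; [exact: Ucd|apply: continuousN; move: x].
  have /continuous_subspaceT : continuous ((fun x => x * A + x ^+ 2 / 2 * B) : R -> R).
    move=> y; apply: cvgD; first by apply: cvgM; [exact: cvg_id|exact: cvg_cst].
    apply: cvgM; last exact: cvg_cst.
    apply: cvgM; last exact: cvg_cst.
    exact: exprn_continuous.
  exact.
have [x xcd] := MVT_segment cd dg gc.
rewrite gE => ->; rewrite normrM [`|d - c|]ger0_norm ?subr_ge0//.
by rewrite ler_wpM2r ?subr_ge0// ue// -in_itv.
Qed.

(* [U] is a primitive of [u] on [[a, b]], expressed by comparison with the
   integrals of affine functions. *)
Definition integral_fun (u : R -> R[i]) a b (U : R -> R[i]) : Prop :=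
  forall (c d : R) (A B : R[i]) (e : R),
    a <= c -> c <= d -> d <= b ->
    (forall x, c <= x <= d -> nr (u x - (A + x%:C * B)) <= e) ->
    nr (U d - U c - ((d - c)%:C * A + ((d ^+ 2 - c ^+ 2) / 2)%:C * B))
      <= 2 * e * (d - c).

(** The real and imaginary parts have separate primitives; adding their two errors produces the
    factor 2 in [integral_fun]. *)
Lemma complex_primitive (u : R -> R[i]) a b : a < b ->
  (forall x, a <= x <= b -> forall e : R, 0 < e ->
     exists2 d : R, 0 < d & forall y, `|y - x| < d -> nr (u y - u x) < e) ->
  exists U, integral_fun u a b U.
Proof.
move=> ab uc.
have part (p : R[i] -> R) : (forall z w, p (z - w) = p z - p w) ->
    (forall z, `|p z| <= nr z) ->
    forall x, a <= x <= b -> {for x, continuous (p \o u)}.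
  move=> pB pnr x xab; apply/cvgrPdist_lt => e e0.
  have [d d0 dP] := uc x xab e e0.
  apply/nbhs_ballP; exists d => // y; rewrite /ball/= distrC => yd.
  by rewrite /= -pB (le_lt_trans (pnr _))// nrB; exact: dP.
have [U1 U1P] := primitive_affine_bound ab
  (part (@complex.Re R) (fun z w => raddfB _ _ _) (@Re_le_nr _)).
have [U2 U2P] := primitive_affine_bound ab
  (part (@complex.Im R) (fun z w => raddfB _ _ _) (@Im_le_nr _)).
exists (fun x => Complex (U1 x) (U2 x)) => c d A B e ac cd db uAB.
apply: le_trans (nr_le_ReIm _) _.
rewrite (_ : 2 * e * (d - c) = e * (d - c) + e * (d - c)); last by ring.
have R1 := U1P c d (complex.Re A) (complex.Re B) e ac cd db.
have R2 := U2P c d (complex.Im A) (complex.Im B) e ac cd db.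
apply: lerD.
- apply: le_trans (R1 _); last first.
    move=> x /uAB; apply: le_trans; apply: le_trans (Re_le_nr _).
    by rewrite /=; case: (u x) A B {R1 R2 uAB} => ? ? [? ?] [? ?]/=; rewrite mul0r subr0.
  by case: A B {R1 R2 uAB} => ? ? [? ?]/=; rewrite !mul0r !subr0.
- apply: le_trans (R2 _); last first.
    move=> x /uAB; apply: le_trans; apply: le_trans (Im_le_nr _).
    by rewrite /=; case: (u x) A B {R1 R2 uAB} => ? ? [? ?] [? ?]/=; rewrite mul0r addr0.
  by case: A B {R1 R2 uAB} => ? ? [? ?]/=; rewrite !mul0r !addr0.
Qed.

End primitive.

Lemma half_power_lt {R : realType} (d : R) : 0 < d ->
  exists n, (2^-1) ^+ n < d.
Proof.
move=> d0; have [n nd] : exists n : nat, d^-1 < n%:R.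
  by exists (Num.bound d^-1); rewrite archi_boundP// invr_ge0 ltW.
exists n; rewrite exprVn invf_plt ?posrE ?exprn_gt0//.
by rewrite (lt_trans nd)// -natrX ltr_nat ltn_expl.
Qed.

Lemma nested_segments {R : realType} (a b : nat -> R) :
  (forall n, a n <= a n.+1) -> (forall n, b n.+1 <= b n) ->
  (forall n, a n <= b n) -> exists x, forall n, a n <= x <= b n.
Proof.
move=> an bn ab.
have amono m n : (m <= n)%N -> a m <= a n.
  by apply: (@homo_leq _ a <=%O) => //; exact: le_trans.
have bmono m n : (m <= n)%N -> b n <= b m.
  move=> mn; rewrite -lerN2; move: m n mn.
  apply: (@homo_leq _ (fun n => - b n) <=%O) => //; first exact: le_trans.
  by move=> n; rewrite lerN2.
have ub n : ubound (range a) (b n).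
  move=> _ [m _ <-]; have := ab (maxn m n) => abmn.
  rewrite (le_trans (amono _ _ (leq_maxl m n)))// (le_trans abmn)//.
  by rewrite bmono// leq_maxr.
exists (sup (range a)) => n; apply/andP; split.
  by apply: ub_le_sup; [exists (b 0); exact: ub|exists n].
by apply: ge_sup; [exists (a 0); exists 0|exact: ub].
Qed.

(** * Goursat's theorem on rectangles, by bisection *)

Section goursat.
Context {R : realType}.
Variables (H P Q : R -> R -> R[i]) (a0 c0 w h : R).
Hypotheses (w0 : 0 < w) (h0 : 0 < h).
(** Complex differentiability in [s + i t], with derivative [A], spelled out with real increments
    because the edges of a rectangle are integrated in [s] and in [t] separately. *)
Hypothesis dH : forall s0 t0, a0 <= s0 <= a0 + w -> c0 <= t0 <= c0 + h ->
  exists A : R[i], forall e : R, 0 < e -> exists2 d : R, 0 < d &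
    forall s t, `|s - s0| < d -> `|t - t0| < d ->
      nr (H s t - H s0 t0 - Complex (s - s0) (t - t0) * A)
        <= e * (`|s - s0| + `|t - t0|).
Hypothesis intP : forall t, c0 <= t <= c0 + h ->
  integral_fun (H ^~ t) a0 (a0 + w) (P t).
Hypothesis intQ : forall s, a0 <= s <= a0 + w ->
  integral_fun (H s) c0 (c0 + h) (Q s).

(* The integral of [H] along the boundary of the rectangle [[a, b] x [c, d]]. *)
Let J a b c d : R[i] :=
  (P c b - P c a) + 'i%C * (Q b d - Q b c)
  - (P d b - P d a) - 'i%C * (Q a d - Q a c).

(** All rectangles of the bisection are similar to the initial one, so a corner and a scale
    determine them. *)
Let Jl a c l := J a (a + l * w) c (c + l * h).

(** The inner edges cancel; with integrals written as increments of [P] and [Q] this is an identity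
    in a ring. *)
Let Jl_split a c l : let m := l * 2^-1 in
  Jl a c l = Jl a c m + Jl (a + m * w) c m + Jl a (c + m * h) m
             + Jl (a + m * w) (c + m * h) m.
Proof.
move=> m; rewrite /Jl.
have -> : a + m * w + m * w = a + l * w by rewrite /m; field.
have -> : c + m * h + m * h = c + l * h by rewrite /m; field.
by rewrite /J; ring.
Qed.

(** Near [(s0, t0)] the function [H] is affine up to [e * (l * (w + h))]. The affine part integrates
    to zero along the boundary, and the error is multiplied by the perimeter [2 * l * (w + h)] and
    by the factor 2 of [integral_fun]. *)
Let Jl_local s0 t0 (e : R) : a0 <= s0 <= a0 + w -> c0 <= t0 <= c0 + h -> 0 < e ->
  exists2 d : R, 0 < d & forall a c l : R, 0 < l -> l * (w + h) < d ->
    a <= s0 <= a + l * w -> c <= t0 <= c + l * h ->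
    a0 <= a -> a + l * w <= a0 + w -> c0 <= c -> c + l * h <= c0 + h ->
    nr (Jl a c l) <= 4 * e * (w + h) ^+ 2 * l ^+ 2.
Proof.
move=> s0P t0P e0; have [A AP] := dH s0P t0P; have [d d0 dP] := AP _ e0.
exists d => // a c l l0 ld as0 ct0 a0a aw c0c ch.
have lw : 0 < l * w by rewrite mulr_gt0.
have lh : 0 < l * h by rewrite mulr_gt0.
have [b bE] : exists b, b = a + l * w by exists (a + l * w).
have [g gE] : exists g, g = c + l * h by exists (c + l * h).
rewrite -bE in as0 aw; rewrite -gE in ct0 ch.
pose K := H s0 t0 - Complex s0 t0 * A.
have HK s t : a <= s <= b -> c <= t <= g ->
    nr (H s t - (K + Complex s t * A)) <= e * (l * (w + h)).
  move=> sab tcg.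
  have s1 : `|s - s0| <= l * w by rewrite ler_norml; apply/andP; split; lra.
  have t1 : `|t - t0| <= l * h by rewrite ler_norml; apply/andP; split; lra.
  have -> : H s t - (K + Complex s t * A) =
      H s t - H s0 t0 - Complex (s - s0) (t - t0) * A.
    have -> : Complex (s - s0) (t - t0) = Complex s t - Complex s0 t0 by [].
    by rewrite /K; ring.
  apply: le_trans (dP _ _ _ _) _; [lra|lra|].
  by rewrite ler_pM2l//; lra.
have cb : c <= g by lra.
have ab : a <= b by lra.
have CE (x y : R) : Complex x y = x%:C + 'i%C * y%:C by rewrite [LHS]complexE.
have E1 t : c <= t <= g -> nr (P t b - P t a -
    ((b - a)%:C * (K + 'i%C * t%:C * A) + ((b ^+ 2 - a ^+ 2) / 2)%:C * A))
    <= 2 * (e * (l * (w + h))) * (b - a).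
  move=> tcg; apply: intP => //; first lra.
  move=> s sab; apply: le_trans (HK s t sab tcg).
  by rewrite (CE s t) le_eqVlt; apply/orP; left; apply/eqP; congr nr; ring.
have E2 s : a <= s <= b -> nr (Q s g - Q s c -
    ((g - c)%:C * (K + s%:C * A) + ((g ^+ 2 - c ^+ 2) / 2)%:C * ('i%C * A)))
    <= 2 * (e * (l * (w + h))) * (g - c).
  move=> sab; apply: intQ => //; first lra.
  move=> t tcg; apply: le_trans (HK s t sab tcg).
  by rewrite (CE s t) le_eqVlt; apply/orP; left; apply/eqP; congr nr; ring.
have {}E1c := E1 c ltac:(lra); have {E1}E1g := E1 g ltac:(lra).
have {}E2a := E2 a ltac:(lra); have {E2}E2b := E2 b ltac:(lra).
move: E1c E1g E2a E2b.
set x1 := (X in nr X <= _); set x2 := (X in _ -> nr X <= _ -> _).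
set x3 := (X in _ -> _ -> nr X <= _ -> _); set x4 := (X in _ -> _ -> _ -> nr X <= _ -> _).
move=> E1c E1g E2a E2b.
(* The integrals of the affine part over the four edges cancel exactly, by [i ^ 2 = -1]. *)
have -> : Jl a c l = (x1 - x2) + 'i%C * (x4 - x3).
  rewrite /Jl /J /x1 /x2 /x3 /x4 -bE -gE.
  rewrite !rmorphB/=.
  have ii : 'i%C * 'i%C = -1 :> R[i] by rewrite -expr2 sqr_i.
  by ring: ii.
have i1 : nr ('i%C : R[i]) = 1.
  by rewrite /nr normc_def/= expr0n/= expr1n add0r sqrtr1.
apply: le_trans (nrD _ _) _; rewrite nrM i1 mul1r.
apply: (@le_trans _ _ (nr x1 + nr x2 + (nr x4 + nr x3))).
  by rewrite lerD// (le_trans (nrD _ _))// nrN.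
have -> : 4 * e * (w + h) ^+ 2 * l ^+ 2 =
   2 * (e * (l * (w + h))) * (b - a) + 2 * (e * (l * (w + h))) * (b - a) +
   (2 * (e * (l * (w + h))) * (g - c) + 2 * (e * (l * (w + h))) * (g - c)).
  by rewrite bE gE; ring.
by rewrite !lerD.
Qed.

(** If the integral has modulus [eta > 0], one of the four quarters keeps at least a quarter of it.
    Iterating gives nested rectangles of scale [l n] with integral at least [eta * l n ^+ 2],
    against the local estimate at their common point. *)
Lemma goursat_rectangle : J a0 (a0 + w) c0 (c0 + h) = 0.
Proof.
apply/eqP; apply: contraT => /nr_gt0; set eta := nr _ => eta0.
pose l n : R := (2^-1) ^+ n.
have l0 n : 0 < l n by rewrite exprn_gt0.
pose good n (p : R * R) := [/\ eta * l n ^+ 2 <= nr (Jl p.1 p.2 (l n)),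
  a0 <= p.1, p.1 + l n * w <= a0 + w, c0 <= p.2 & p.2 + l n * h <= c0 + h].
pose sub n (p q : R * R) := [/\ p.1 <= q.1, q.1 + l n.+1 * w <= p.1 + l n * w,
  p.2 <= q.2 & q.2 + l n.+1 * h <= p.2 + l n * h].
have step n (p : R * R) : exists q, good n p -> good n.+1 q /\ sub n p q.
  case: (pselect (good n p)) => [|np]; last by exists p.
  case: p => a c gp; have [/= Jge p1 p2 p3 p4] := gp.
  have lS : l n.+1 = l n * 2^-1 by rewrite /l exprSr.
  pose m := l n.+1.
  have mw : 0 < m * w by rewrite mulr_gt0// /m.
  have mh : 0 < m * h by rewrite mulr_gt0// /m.
  have lmw : l n * w = m * w + m * w by rewrite /m lS; field.
  have lmh : l n * h = m * h + m * h by rewrite /m lS; field.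
  suff [q [q1 q2 q3]] : exists q : R * R, [/\ eta * m ^+ 2 <= nr (Jl q.1 q.2 m),
      q.1 = a \/ q.1 = a + m * w & q.2 = c \/ q.2 = c + m * h].
    case: q q1 q2 q3 => qa qb /= q1 q2 q3; exists (qa, qb) => _.
    by split; split => //=; rewrite -/m; clear q1; case: q2 => ?; case: q3 => ?; subst; lra.
  apply: contrapT => /forallNP nq.
  have lt q1 q2 : q1 = a \/ q1 = a + m * w -> q2 = c \/ q2 = c + m * h ->
      nr (Jl q1 q2 m) < eta * m ^+ 2.
    by move=> h1 h2; rewrite ltNge; apply/negP => h3; apply: (nq (q1, q2)).
  have := lt a c (or_introl erefl) (or_introl erefl).
  have := lt (a + m * w) c (or_intror erefl) (or_introl erefl).
  have := lt a (c + m * h) (or_introl erefl) (or_intror erefl).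
  have := lt (a + m * w) (c + m * h) (or_intror erefl) (or_intror erefl).
  move: Jge; rewrite Jl_split -lS -/m.
  set j1 := Jl a c m; set j2 := Jl _ c m; set j3 := Jl a _ m; set j4 := Jl _ _ m.
  have -> : eta * l n ^+ 2 = 4 * (eta * m ^+ 2) by rewrite /m lS; field.
  have := nrD (j1 + j2 + j3) j4; have := nrD (j1 + j2) j3; have := nrD j1 j2.
  lra.
have [f fP] := choice (fun np => step np.1 np.2).
pose p := fix p n := if n is n'.+1 then f (n', p n') else (a0, c0).
have good0 : good 0 (p 0).
  by split => //=; rewrite /l expr0 ?expr1n ?mulr1 ?mul1r// /Jl !mul1r.
have goodp n : good n (p n).
  by elim: n => // n IH; have [] := fP (n, p n) IH.
have subp n : sub n (p n) (p n.+1) by have [] := fP (n, p n) (goodp n).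
have lw n : 0 < l n * w by rewrite mulr_gt0.
have lh n : 0 < l n * h by rewrite mulr_gt0.
have [s0 s0P] : exists s0, forall n, (p n).1 <= s0 <= (p n).1 + l n * w.
  apply: nested_segments => n; [by case: (subp n)|by case: (subp n)|].
  by rewrite lerDl ltW.
have [t0 t0P] : exists t0, forall n, (p n).2 <= t0 <= (p n).2 + l n * h.
  apply: nested_segments => n; [by case: (subp n)|by case: (subp n)|].
  by rewrite lerDl ltW.
have wh0 : 0 < w + h by rewrite addr_gt0.
(* Chosen so that the bound of [Jl_local] becomes [eta * l n ^+ 2 / 2]. *)
pose e := eta / (8 * (w + h) ^+ 2).
have e0 : 0 < e by rewrite divr_gt0// mulr_gt0// exprn_gt0.
have s00 : a0 <= s0 <= a0 + w by have := s0P 0%N; rewrite /= /l expr0 mul1r.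
have t00 : c0 <= t0 <= c0 + h by have := t0P 0%N; rewrite /= /l expr0 mul1r.
have [d d0 dP] := Jl_local s00 t00 e0.
have [n nd] := half_power_lt (divr_gt0 d0 wh0).
have [g1 g2 g3 g4 g5] := goodp n.
have := dP _ _ _ (l0 n) _ (s0P n) (t0P n) g2 g3 g4 g5.
rewrite -ltr_pdivlMr// => /(_ nd) /(le_trans g1).
have -> : 4 * e * (w + h) ^+ 2 * l n ^+ 2 = eta * l n ^+ 2 / 2.
  by rewrite /e; field; rewrite gt_eqF.
have : 0 < eta * l n ^+ 2 by rewrite mulr_gt0// exprn_gt0.
lra.
Qed.

End goursat.

Lemma is_derive_affine_approx {R : realType} (f : R -> R) (x df : R) :
  is_derive x 1 f df -> forall e : R, 0 < e -> exists2 d : R, 0 < d &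
    forall h, `|h| < d -> `|f (x + h) - f x - h * df| <= e * `|h|.
Proof.
move=> fx e e0; have fd : differentiable f x by apply/derivable1_diffP.
have /eqaddoP/(_ e e0) := diff_locally fd.
move=> /nbhs_ballP[d d0 dP]; exists d => // h hd.
have := dP h; rewrite /ball/= sub0r normrN => /(_ hd).
rewrite !fctE/= deriv1E// derive1E derive_val opprD addrA [h + x]addrC.
by rewrite /cst.
Qed.

(** * The exponential of [s + i t], which wraps rectangles onto annuli *)

Section complex_exponential.
Context {R : realType}.

Definition cexp (s t : R) : R[i] := (expR s)%:C * Complex (cos t) (sin t).

Lemma cexpD s s' t t' : cexp (s + s') (t + t') = cexp s t * cexp s' t'.
Proof.
have -> : cexp s t * cexp s' t' = (expR s * expR s')%:C *
   (Complex (cos t) (sin t) * Complex (cos t') (sin t')).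
  by rewrite /cexp rmorphM/=; ring.
rewrite /cexp expRD; congr (_ * _).
by rewrite cosD sinD; apply/eqP; rewrite eq_complex/= eqxx/= addrC
  [cos t * sin t']mulrC [sin t * cos t']mulrC [cos t' * _]mulrC
  [sin t' * _]mulrC addrC eqxx.
Qed.

Lemma nr_cexp s t : nr (cexp s t) = expR s.
Proof.
rewrite nrM nr_real ger0_norm ?expR_ge0//.
by rewrite /nr normc_def/= cos2Dsin2 sqrtr1 mulr1.
Qed.

Lemma cexp2pi s : cexp s (2 * pi) = cexp s 0.
Proof. by rewrite /cexp mulr_natl cos2pi sin2pi cos0 sin0. Qed.

Lemma cexp_diff0 (e : R) : 0 < e -> exists2 d : R, 0 < d &
  forall s t, `|s| < d -> `|t| < d ->
    nr (cexp s t - 1 - Complex s t) <= e * (`|s| + `|t|).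
Proof.
(* The total error is at most [e / 8 * |s| + 6 * (e / 8) * |t|]. The cap at 1 serves to bound
   [|expR s - 1|] by [2 * |s|]. *)
move=> e0; have e8 : 0 < Num.min (e / 8) 1 by rewrite lt_min ltr01 divr_gt0.
have [d1 d10 d1P] := is_derive_affine_approx (is_derive_expR 0) e8.
have [d2 d20 d2P] := is_derive_affine_approx (is_derive_cos 0) e8.
have [d3 d30 d3P] := is_derive_affine_approx (is_derive_sin 0) e8.
have {}e8 : Num.min (e / 8) 1 <= e / 8 /\ Num.min (e / 8) 1 <= 1.
  by rewrite !ge_min !lexx orbT.
set m := Num.min (e / 8) 1 in e8 d1P d2P d3P.
have [d dP] : exists d : R, [/\ 0 < d, d <= d1, d <= d2, d <= d3 & d <= Num.min (e / 8) (1 / 4)].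
  exists (Num.min d1 (Num.min d2 (Num.min d3 (Num.min (e / 8) (1 / 4))))).
  by rewrite !lt_min d10 d20 d30 !divr_gt0//; split=> //;
    rewrite ?le_min ?ge_min ?lexx ?orbT// !ge_min !lexx !orbT.
case: dP => d0 dd1 dd2 dd3; rewrite le_min => /andP[de d1l].
exists d => // s t sd td.
have {d1P} := d1P s (lt_le_trans sd dd1).
have {d2P} := d2P t (lt_le_trans td dd2).
have {d3P} := d3P t (lt_le_trans td dd3).
rewrite !add0r expR0 sin0 cos0 !mulr1 oppr0 mulr0 !subr0 ?addr0 => h3 h2 h1.
apply: le_trans (nr_le_ReIm _) _.
have -> : complex.Re (cexp s t - 1 - Complex s t) = (expR s - 1 - s) + expR s * (cos t - 1).
  by rewrite /cexp /=; ring.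
have -> : complex.Im (cexp s t - 1 - Complex s t) = expR s * (sin t - t) + (expR s - 1) * t.
  by rewrite /cexp /=; ring.
have s0 := normr_ge0 s; have t0 := normr_ge0 t.
have ms : m * `|s| <= e / 8 * `|s| by rewrite ler_wpM2r//; lra.
have mt : m * `|t| <= e / 8 * `|t| by rewrite ler_wpM2r//; lra.
have ms1 : m * `|s| <= `|s| by rewrite -[leRHS]mul1r ler_wpM2r//; lra.
have hs : `|expR s - 1| <= 2 * `|s|.
  have -> : expR s - 1 = (expR s - 1 - s) + s by ring.
  by apply: le_trans (ler_normD _ _) _; lra.
have hE : `|expR s| <= 2.
  have -> : expR s = (expR s - 1) + 1 by ring.
  by apply: le_trans (ler_normD _ _) _; rewrite normr1; lra.
have k1 : `|expR s * (cos t - 1)| <= 2 * (e / 8 * `|t|).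
  by rewrite normrM ler_pM//; lra.
have k2 : `|expR s * (sin t - t)| <= 2 * (e / 8 * `|t|).
  by rewrite normrM ler_pM//; lra.
have k3 : `|(expR s - 1) * t| <= (2 * (e / 8)) * `|t|.
  by rewrite normrM ler_wpM2r//; lra.
have l1 := ler_normD (expR s - 1 - s) (expR s * (cos t - 1)).
have l2 := ler_normD (expR s * (sin t - t)) ((expR s - 1) * t).
have es : 0 <= e * `|s| by rewrite mulr_ge0// ltW.
have et : 0 <= e * `|t| by rewrite mulr_ge0// ltW.
rewrite [leRHS]mulrDr; lra.
Qed.

(* The chain rule for [g] composed with the exponential, in the logarithmic
   coordinates [s + i t]. *)
Lemma comp_cexp_diff (g : R[i] -> R[i]) s0 t0 : differentiable g (cexp s0 t0) ->
  exists A : R[i], forall e : R, 0 < e -> exists2 d : R, 0 < d &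
    forall s t, `|s - s0| < d -> `|t - t0| < d ->
      nr (g (cexp s t) - g (cexp s0 t0) - Complex (s - s0) (t - t0) * A)
        <= e * (`|s - s0| + `|t - t0|).
Proof.
set z0 := cexp s0 t0 => dg; pose A0 := 'd g z0 1.
exists (z0 * A0) => e e0.
have z00 : 0 < nr z0 by rewrite nr_cexp expR_gt0.
have A00 := nr_ge0 A0.
have e1 : 0 < e / (4 * nr z0) by rewrite divr_gt0// mulr_gt0.
have zA : 0 <= nr z0 * nr A0 by rewrite mulr_ge0// ltW.
have e2 : 0 < Num.min 1 (e / (2 * (nr z0 * nr A0 + 1))).
  by rewrite lt_min ltr01 divr_gt0//; lra.
have [d1 d10 d1P] := diff_nrP dg e1.
have [d2 d20 d2P] := cexp_diff0 e2.
set m := Num.min _ _ in e2 d2P.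
have m1 : m <= 1 by rewrite ge_min lexx.
have m2 : m * (2 * (nr z0 * nr A0 + 1)) <= e.
  by rewrite -ler_pdivlMr ?ge_min ?lexx ?orbT//; lra.
exists (Num.min d2 (d1 / (4 * nr z0))).
  by rewrite lt_min d20 divr_gt0// mulr_gt0.
move=> s t; rewrite !lt_min !ltr_pdivlMr ?mulr_gt0// => /andP[sd2 sd1] /andP[td2 td1].
have {d2P} := d2P _ _ sd2 td2.
set a := s - s0 in sd2 sd1 *; set b := t - t0 in td2 td1 *.
set k := cexp a b - 1 - Complex a b => kab.
have ab : nr (Complex a b) <= `|a| + `|b| by apply: le_trans (nr_le_ReIm _) _.
have cE : cexp s t = z0 + z0 * (Complex a b + k).
  rewrite -[s](subrK s0) -[t](subrK t0) -/a -/b cexpD -/z0 /k; ring.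
have ab0 : 0 <= `|a| + `|b| by rewrite addr_ge0.
have km : nr k <= `|a| + `|b|.
  by apply: le_trans kab _; rewrite -[leRHS]mul1r ler_wpM2r.
have ck : nr (Complex a b + k) <= 2 * (`|a| + `|b|).
  by apply: le_trans (nrD _ _) _; lra.
have zk : nr (z0 * (Complex a b + k)) <= nr z0 * (2 * (`|a| + `|b|)).
  by rewrite nrM ler_pM2l.
have {d1P} := d1P (z0 * (Complex a b + k)) (le_lt_trans zk _).
have -> : 'd g z0 (z0 * (Complex a b + k)) = z0 * (Complex a b + k) * A0.
  by rewrite -[z0 * _ in LHS]mulr1 -[_ * 1]/(_ *: 1) linearZ.
rewrite -cE => H.
have {}H : nr (g (cexp s t) - g z0 - z0 * (Complex a b + k) * A0)
    <= e / (4 * nr z0) * nr (z0 * (Complex a b + k)) by apply: H; lra.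
have -> : g (cexp s t) - g z0 - Complex a b * (z0 * A0) =
  (g (cexp s t) - g z0 - z0 * (Complex a b + k) * A0) + z0 * A0 * k by ring.
apply: le_trans (nrD _ _) _.
have H1 : e / (4 * nr z0) * nr (z0 * (Complex a b + k)) <= e / 2 * (`|a| + `|b|).
  apply: (@le_trans _ _ (e / (4 * nr z0) * (nr z0 * (2 * (`|a| + `|b|))))).
    by rewrite ler_pM2l.
  by rewrite le_eqVlt; apply/orP; left; apply/eqP; field; rewrite gt_eqF.
have H2 : nr (z0 * A0 * k) <= e / 2 * (`|a| + `|b|).
  rewrite (nrM (z0 * A0)) (nrM z0 A0); apply: (@le_trans _ _ (nr z0 * nr A0 * (m * (`|a| + `|b|)))).
    by rewrite ler_wpM2l.
  by rewrite mulrA ler_wpM2r//; lra.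
lra.
Qed.

End complex_exponential.

Lemma differentiable_translate {K : numFieldType} {V W : normedModType K}
    (f : V -> W) (a z : V) :
  differentiable f (a + z) -> differentiable (fun h => f (a + h)) z.
Proof.
move=> fz; apply: (@differentiable_comp _ _ _ _ (fun h => a + h) f) => //.
Qed.

(** The mean of [g] over a circle around 0 is independent of the radius: pull back by [cexp] and
    apply Goursat to a rectangle of height [2 * pi], whose horizontal edges cancel by periodicity.
    Small circles give [g 0], the large one gives [M]. The image of the rectangle avoids 0, so
    continuity at 0 suffices there. The factor 2 is that of [integral_fun]. *)
Lemma circle_bound {R : realType} (g : R[i] -> R[i]) (r M : R) :
  (forall z, 0 < nr z -> nr z <= r -> differentiable g z) ->
  (forall e : R, 0 < e -> exists2 d : R, 0 < d &
     forall z, nr z < d -> nr (g z - g 0) < e) ->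
  0 < r -> (forall z, nr z = r -> nr (g z) <= M) ->
  nr (g 0) <= 2 * M.
Proof.
move=> dg g0 r0 gM.
pose H s t := g (cexp s t).
pose s2 := ln r.
have es2 : expR s2 = r by rewrite lnK.
apply/ler_addgt0Pr => e e0.
have [d d0 dP] := g0 (e / 2) ltac:(by rewrite divr_gt0).
(* The inner circle has radius at most [d / 2], and [s2 - 1] keeps the rectangle from
   degenerating. *)
pose s1 := Num.min (s2 - 1) (ln (d / 2)).
have es1 : expR s1 < d.
  apply: (@le_lt_trans _ _ (d / 2)); last lra.
  by rewrite -[leRHS](@lnK _ (d / 2)) ?posrE ?divr_gt0// ler_expR ge_min lexx orbT.
have w0 : 0 < s2 - s1.
  have : s1 <= s2 - 1 by rewrite ge_min lexx.
  lra.
have h0 : 0 < 2 * pi :> R by rewrite mulr_gt0// pi_gt0.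
have dH (s0 t0 : R) : s1 <= s0 <= s1 + (s2 - s1) -> 0 <= t0 <= 0 + 2 * pi ->
  exists A : R[i], forall e : R, 0 < e -> exists2 d : R, 0 < d &
    forall s t, `|s - s0| < d -> `|t - t0| < d ->
      nr (H s t - H s0 t0 - Complex (s - s0) (t - t0) * A)
        <= e * (`|s - s0| + `|t - t0|).
  move=> s0P _; apply: comp_cexp_diff; apply: dg; rewrite nr_cexp ?expR_gt0//.
  by rewrite -es2 ler_expR; lra.
have cH (s0 t0 e' : R) : s1 <= s0 <= s1 + (s2 - s1) -> 0 <= t0 <= 0 + 2 * pi ->
  0 < e' -> exists2 d : R, 0 < d &
    forall s t, `|s - s0| < d -> `|t - t0| < d -> nr (H s t - H s0 t0) < e'.
  move=> s0P t0P e'0; have [A /(_ 1 ltr01)[d' d'0 d'P]] := dH s0 t0 s0P t0P.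
  have A0 := nr_ge0 A.
  exists (Num.min d' (e' / (2 * (nr A + 1)))).
    by rewrite lt_min d'0 divr_gt0//; lra.
  move=> s t; rewrite !lt_min !ltr_pdivlMr; try lra.
  move=> /andP[sd' se'] /andP[td' te'].
  have {d'P} := d'P _ _ sd' td'; rewrite mul1r => d'P.
  have -> : H s t - H s0 t0 = H s t - H s0 t0 - Complex (s - s0) (t - t0) * A +
     Complex (s - s0) (t - t0) * A by ring.
  apply: le_lt_trans (nrD _ _) _.
  have : nr (Complex (s - s0) (t - t0) * A) <= (`|s - s0| + `|t - t0|) * nr A.
    by rewrite nrM ler_wpM2r//; apply: le_trans (nr_le_ReIm _) _.
  have : 0 <= `|s - s0| by []. have : 0 <= `|t - t0| by [].
  lra.
(* The primitive is chosen as a function of the integrand, with the default 0. Equal integrands then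
   have equal primitives, so the edges [t = 0] and [t = 2 * pi] cancel without comparing two
   primitives. *)
have integrals (a b : R) : a < b -> exists I : (R -> R[i]) -> R -> R[i], forall u,
    (forall x : R, a <= x <= b -> forall e : R, 0 < e ->
     exists2 d : R, 0 < d & forall y, `|y - x| < d -> nr (u y - u x) < e) ->
    integral_fun u a b (I u).
  move=> ab; suff /choice[I IP] : forall u : R -> R[i], exists U, (forall x : R, a <= x <= b ->
      forall e : R, 0 < e -> exists2 d : R, 0 < d &
        forall y, `|y - x| < d -> nr (u y - u x) < e) -> integral_fun u a b U.
    by exists I.
  move=> u.
  have [uc|nuc] := pselect (forall x : R, a <= x <= b -> forall e : R, 0 < e ->
     exists2 d : R, 0 < d & forall y, `|y - x| < d -> nr (u y - u x) < e).
    by have [U UP] := complex_primitive ab uc; exists U.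
  by exists (fun=> 0) => uc; case: nuc.
have [I IP] := integrals s1 (s1 + (s2 - s1)) ltac:(lra).
have [K KP] := integrals 0 (0 + 2 * pi) ltac:(lra).
have intP t : 0 <= t <= 0 + 2 * pi ->
    integral_fun (H ^~ t) s1 (s1 + (s2 - s1)) (I (H ^~ t)).
  move=> tP; apply: IP => s sP e' e'0; have [d' d'0 d'P] := cH s t e' sP tP e'0.
  by exists d' => // s' s'd; apply: d'P; rewrite // subrr normr0.
have intQ s : s1 <= s <= s1 + (s2 - s1) ->
    integral_fun (H s) 0 (0 + 2 * pi) (K (H s)).
  move=> sP; apply: KP => t tP e' e'0; have [d' d'0 d'P] := cH s t e' sP tP e'0.
  by exists d' => // s' s'd; apply: d'P; rewrite // subrr normr0.
have := goursat_rectangle w0 h0 dH intP intQ.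
rewrite /= add0r (_ : H ^~ (2 * pi) = H ^~ 0); last first.
  by apply/funext => s; rewrite /H cexp2pi.
rewrite (_ : s1 + (s2 - s1) = s2); last by ring.
set k1 := K (H s1) _ - _; set k2 := K (H s2) _ - _; set j := I _ _ - _.
have -> : j + 'i%C * k2 - j - 'i%C * k1 = 'i%C * (k2 - k1) by ring.
move=> /eqP; rewrite mulf_eq0 eq_complex/= oner_eq0 andbF/= subr_eq0 => /eqP k12.
have B2 : nr k2 <= 2 * M * (2 * pi).
  have := intQ s2 ltac:(lra) 0 (2 * pi) 0 0 M (lexx _) (ltW h0) _ _.
  rewrite !add0r !mulr0 !addr0 !subr0 => /(_ (lexx _)); apply.
  by move=> t _; rewrite mulr0 addr0 subr0 gM// nr_cexp.
have B1 : nr (k1 - (2 * pi)%:C * g 0) <= 2 * (e / 2) * (2 * pi).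
  have := intQ s1 ltac:(lra) 0 (2 * pi) (g 0) 0 (e / 2) (lexx _) (ltW h0) _ _.
  rewrite !add0r !mulr0 !addr0 !subr0 => /(_ (lexx _)); apply.
  by move=> t _; rewrite mulr0 addr0 ltW// dP// nr_cexp.
have : nr ((2 * pi)%:C * g 0) <= nr k1 + 2 * (e / 2) * (2 * pi).
  have -> : (2 * pi)%:C * g 0 = k1 - (k1 - (2 * pi)%:C * g 0) by ring.
  by apply: le_trans (nrD _ _) _; rewrite nrN lerD2l.
rewrite nrM nr_real gtr0_norm// -k12 => B.
rewrite -(ler_pM2l h0); lra.
Qed.

(* Cauchy's estimate, up to a constant: apply [circle_bound] to the difference
   quotient of [f]. *)
Lemma cauchy_estimate {R : realType} (f : R[i] -> R[i]) (a : R[i]) (r M : R) :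
  0 < r -> (forall z, nr (z - a) <= r -> differentiable f z) ->
  (forall z, nr (z - a) <= r -> nr (f z) <= M) ->
  nr ('d f a 1) <= 4 * M / r.
Proof.
move=> r0 df fM.
have dfa : differentiable f a by apply: df; rewrite subrr nr0 ltW.
pose g (h : R[i]) : R[i] := if h == 0 then 'd f a 1 else (f (a + h) - f a) / h.
have -> : 'd f a 1 = g 0 by rewrite /g eqxx.
have -> : 4 * M / r = 2 * (2 * M / r) by field; rewrite gt_eqF.
have ah (h : R[i]) : a + h - a = h by rewrite addrC addKr.
apply: (@circle_bound R g r (2 * M / r)); [ | |exact: r0| ].
- move=> z z0 zr; have zn0 : z != 0 by apply: contraTneq z0 => ->; rewrite nr0 ltxx.
  have d2 : differentiable (fun h : R[i] => f (a + h)) z.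
    by apply: differentiable_translate; apply: df; rewrite ah.
  have d3 : differentiable (fun h : R[i] => f (a + h) - f a) z.
    exact: (differentiableB d2 (differentiable_cst (f a) z)).
  have d4 : differentiable (fun h : R[i] => h^-1) z.
    exact: differentiable_Rinv.
  have d5 : differentiable (fun h : R[i] => (f (a + h) - f a) * h^-1) z.
    exact: (differentiableM d3 d4).
  apply/derivable1_diffP; move/derivable1_diffP : d5.
  apply: near_eq_derivable.
  apply/nbhs_nrP; exists (nr z) => // w wz; rewrite /g ifF//.
  by apply: contraTF wz => /eqP ->; rewrite add0r nrN ltxx.
- move=> e e0; have e2 : 0 < e / 2 by rewrite divr_gt0.
  have [d d0 dP] := diff_nrP dfa e2.
  exists d => // z zd; rewrite /g eqxx; case: ifPn => [_|z0].
    by rewrite subrr nr0.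
  have -> : (f (a + z) - f a) / z - 'd f a 1 = (f (a + z) - f a - 'd f a z) / z.
    have -> : 'd f a z = z * 'd f a 1.
      by rewrite -[z in LHS]mulr1 -[_ * 1]/(_ *: 1) linearZ.
    by rewrite [in RHS]mulrBl [z * _]mulrC mulfK.
  have z1 := nr_gt0 z0.
  rewrite nrM nrV ltr_pdivrMr// (le_lt_trans (dP _ zd))// ltr_pM2r//; lra.
- move=> z zr; have z0 : z != 0 by apply: contraTneq r0 => z0; rewrite -zr z0 nr0 ltxx.
  rewrite /g (negbTE z0) nrM nrV zr ler_pM2r ?invr_gt0//.
  apply: le_trans (nrD _ _) _; rewrite nrN.
  have := fM (a + z); rewrite ah zr lexx => /(_ isT).
  have := fM a; rewrite subrr nr0 => /(_ (ltW r0)); lra.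
Qed.

Lemma affine_approx_is_derive {R : realType} (f : R -> R) (x df : R) :
  (forall e : R, 0 < e -> exists2 d : R, 0 < d &
    forall h, `|h| < d -> `|f (x + h) - f x - h * df| <= e * `|h|) ->
  is_derive x 1 f df.
Proof.
move=> fx; have H : h^-1 *: (f (h + x) - f x) @[h --> 0^'] --> df.
  apply/cvgrPdist_le => e e0; have [d d0 dP] := fx e e0.
  near=> h; have h0 : h != 0 by near: h; exact: nbhs_dnbhs_neq.
  rewrite distrC -[_ *: _]/(_ * _).
  have -> : h^-1 * (f (h + x) - f x) - df = h^-1 * (f (x + h) - f x - h * df).
    by rewrite [h + x]addrC [in RHS]mulrBr mulrA mulVf// mul1r.
  rewrite normrM normfV ler_pdivrMl ?normr_gt0// [leRHS]mulrC dP//.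
  near: h; apply: dnbhs0_lt; exact: d0.
have H1 : h^-1 *: (f (h *: 1 + x) - f x) @[h --> 0^'] --> df.
  by under eq_fun do rewrite [_ *: 1]mulr1.
apply: DeriveDef; first by apply/cvg_ex; exists df.
exact/cvg_lim.
Unshelve. all: by end_near. Qed.

(** * Holomorphic maps are continuously differentiable *)

Section derivative_bounds.
Context {R : realType}.

(** The mean value theorem is real, so it is applied to both parts of [phi] on the segment; this
    costs the factor 2. *)
Lemma complex_mean_value (phi : R[i] -> R[i]) (L : R) :
  (forall t : R, 0 <= t <= 1 -> differentiable phi (t%:C)) ->
  (forall t : R, 0 <= t <= 1 -> nr ('d phi (t%:C) 1) <= L) ->
  nr (phi 1 - phi 0) <= 2 * L.
Proof.
move=> dphi phiL.
have part (p : R[i] -> R) : (forall z w, p (z - w) = p z - p w) ->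
    (forall (r : R) z, p (r%:C * z) = r * p z) ->
    (forall z, `|p z| <= nr z) -> `|p (phi 1 - phi 0)| <= L.
  move=> pB pZ pnr.
  pose u (t : R) := p (phi t%:C).
  have du (t : R) : 0 <= t <= 1 -> is_derive t 1 u (p ('d phi (t%:C) 1)).
    move=> t01; apply: affine_approx_is_derive => e e0.
    have [d d0 dP] := diff_nrP (dphi t t01) e0.
    exists d => // h hd; rewrite /u -pZ -!pB (le_trans (pnr _))//.
    have := dP h%:C; rewrite nr_real => /(_ hd); apply: le_trans.
    rewrite rmorphD/= le_eqVlt; apply/orP; left; apply/eqP; congr nr; congr (_ - _).
    by rewrite -[h%:C in RHS]mulr1 -[_ * 1]/(_ *: 1) linearZ.
  have uc : {within `[0, 1], continuous u}.
    apply: derivable_within_continuous => t; rewrite in_itv/= => t01.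
    by apply: ex_derive; exact: du.
  have [t] := MVT (@ltr01 R)
    (fun t tin => du t ltac:(move: tin; rewrite in_itv/= => /andP[? ?]; lra)) uc.
  rewrite in_itv/= => /andP[t0 t1]; rewrite subr0 mulr1 /u => uE.
  by rewrite pB uE (le_trans (pnr _))// phiL// !ltW.
apply: le_trans (nr_le_ReIm _) _; rewrite mulrDl mul1r lerD//.
- apply: part; [by move=> z w; rewrite raddfB| |exact: Re_le_nr].
  by move=> r [a b]/=; rewrite mul0r subr0.
- apply: part; [by move=> z w; rewrite raddfB| |exact: Im_le_nr].
  by move=> r [a b]/=; rewrite mul0r addr0.
Qed.

Lemma differentiable_line {K : numFieldType} {V W : normedModType K}
    (f : V -> W) (w v : V) (c : K) :
  differentiable f (w + c *: v) -> differentiable (fun c : K => f (w + c *: v)) c.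
Proof.
move=> fz; apply: (@differentiable_comp _ _ _ _ (fun c : K => w + c *: v) f) => //.
Qed.

Context {V : normedModType R[i]}.

Lemma nr_convex (z0 w w' : V) (t r : R) : 0 <= t <= 1 ->
  nr (w - z0) < r -> nr (w' - z0) < r -> nr (w + t%:C *: (w' - w) - z0) < r.
Proof.
move=> /andP[t0 t1] wr w'r.
have -> : w + t%:C *: (w' - w) - z0 = (1 - t)%:C *: (w - z0) + t%:C *: (w' - z0).
  rewrite rmorphB scalerBl scale1r -[RHS]addrA [- _ + _]addrC -scalerBr.
  by rewrite opprB addrA subrK addrAC.
apply: le_lt_trans (nrD _ _) _; rewrite !nrZr !ger0_norm ?subr_ge0//.
have [->|tn0] := eqVneq t 0; first by rewrite subr0 mul1r mul0r addr0.
have tgt0 : 0 < t by rewrite lt_neqAle eq_sym tn0.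
have h1 : 0 < t * (r - nr (w' - z0)) by rewrite mulr_gt0// subr_gt0.
have h2 : 0 <= (1 - t) * (r - nr (w - z0)) by rewrite mulr_ge0// subr_ge0// ltW.
lra.
Qed.

(** Cauchy's estimate on the complex line through [w] and [w']. The discs of radius [rho] centred on
    the segment have radius [r / 4] in [V], so they stay in the ball of radius [r]. The constant is
    [32 = 2 * 4 * 4]: mean value, Cauchy, and [rho]. *)
Lemma holomorphic_lipschitz (f : V -> R[i]) (z0 : V) (r M : R) : 0 < r ->
  (forall z, nr (z - z0) < r -> differentiable f z) ->
  (forall z, nr (z - z0) < r -> nr (f z) <= M) ->
  forall w w', nr (w - z0) < r / 2 -> nr (w' - z0) < r / 2 ->
  nr (f w' - f w) <= 32 * M / r * nr (w' - w).
Proof.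
move=> r0 df fM w w' wr w'r.
have [->|ww'] := eqVneq w' w; first by rewrite !subrr !nr0 mulr0.
set v := w' - w; have v0 : 0 < nr v by rewrite nr_gt0// subr_eq0.
pose rho := r / (4 * nr v).
have rho0 : 0 < rho by rewrite divr_gt0// mulr_gt0.
pose phi (c : R[i]) := f (w + c *: v).
have near_seg (t : R) : 0 <= t <= 1 -> forall c : R[i], nr (c - t%:C) <= rho ->
    nr (w + c *: v - z0) < r.
  move=> t01 c ct.
  have -> : w + c *: v - z0 = (c - t%:C) *: v + (w + t%:C *: v - z0).
    by rewrite scalerBl addrAC [w + _ - z0 in RHS]addrAC [_ + t%:C *: v]addrC addrA subrK addrC.
  have := nr_convex t01 wr w'r.
  have : nr ((c - t%:C) *: v) <= r / 4.
    rewrite nrZ; apply: le_trans (ler_wpM2r (nr_ge0 v) ct) _.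
    by rewrite /rho le_eqVlt; apply/orP; left; apply/eqP; field; rewrite gt_eqF.
  have := nrD ((c - t%:C) *: v) (w + t%:C *: v - z0).
  lra.
have -> : f w' - f w = phi 1 - phi 0.
  by rewrite /phi scale1r scale0r addr0 /v [w + _]addrC subrK.
have -> : 32 * M / r * nr v = 2 * (4 * M / rho * 1) * 1.
  by rewrite /rho; field; rewrite !gt_eqF.
rewrite mulr1; apply: complex_mean_value => t t01.
  apply: differentiable_line; apply: df; apply: (near_seg t) => //.
  by rewrite subrr nr0 ltW.
rewrite mulr1; apply: cauchy_estimate => // c ct.
  by apply: differentiable_line; apply: df; exact: (near_seg t).
by apply: fM; exact: (near_seg t).
Qed.

(* The difference quotients of [f] along [v] are uniformly Lipschitz by
   [holomorphic_lipschitz]; hence so is their limit. *)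
Lemma differential_lipschitz (f : V -> R[i]) (z0 : V) (r M : R) : 0 < r ->
  (forall z, nr (z - z0) < r -> differentiable f z) ->
  (forall z, nr (z - z0) < r -> nr (f z) <= M) ->
  exists L : R, forall w w' v, nr (w - z0) < r / 8 -> nr (w' - z0) < r / 8 ->
    nr ('d f w' v - 'd f w v) <= L * nr v * nr (w' - w).
Proof.
(* [4096 = 32 * 32 * 4]: [holomorphic_lipschitz] is used on the radius [r] to bound the difference
   quotients, then on [r / 4] for the quotients themselves. *)
move=> r0 df fM; exists (4096 * M / r ^+ 2) => w w' v wr w'r.
have v0 := nr_ge0 v.
apply/ler_addgt0Pr => e e0.
(* Here and in the choice of [s], the [+ 1] keeps the denominator positive when [v = 0]. *)
pose eta := e / (2 * (nr v + 1)).
have eta0 : 0 < eta by rewrite divr_gt0//; lra.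
have [d d0 dP] := diff_nrP (df w ltac:(lra)) eta0.
have [d' d'0 d'P] := diff_nrP (df w' ltac:(lra)) eta0.
have [s [s0 sd sd' sr]] : exists s : R, [/\ 0 < s, s * nr v < d, s * nr v < d' &
    s * nr v < r / 4].
  exists (Num.min d (Num.min d' (r / 4)) / (nr v + 1)).
  have nv1 : 0 < nr v + 1 by lra.
  have m0 : 0 < Num.min d (Num.min d' (r / 4)) by rewrite !lt_min d0 d'0 divr_gt0.
  set m := Num.min _ _ in m0 *.
  have E (x : R) : m <= x -> m / (nr v + 1) * nr v < x.
    by move=> mx; rewrite -mulrA [_^-1 * _]mulrC mulrA ltr_pdivrMr//; nra.
  by split; [rewrite divr_gt0|apply: E|apply: E|apply: E];
    rewrite ?ge_min ?lexx ?orbT.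
have nsv : nr (s%:C *: v) = s * nr v by rewrite nrZr gtr0_norm.
pose phi (z : V) : R[i] := (s^-1)%:C * (f (z + s%:C *: v) - f z).
have phid z : nr (z - z0) < r / 4 -> differentiable phi z.
  move=> zr.
  have d1 : differentiable (fun z => f (z + s%:C *: v)) z.
    under eq_fun do rewrite addrC.
    apply: differentiable_translate; apply: (df (s%:C *: v + z)).
    rewrite [_ + z]addrC addrAC.
    apply: le_lt_trans (nrD _ _) _; rewrite nsv; lra.
  have d2 : differentiable f z by apply: df; lra.
  exact: (differentiableZ _ (differentiableB d1 d2)).
have phiM z : nr (z - z0) < r / 4 -> nr (phi z) <= 32 * M / r * nr v.
  move=> zr; rewrite nrM nr_real gtr0_norm ?invr_gt0// ler_pdivrMl//.
  have zsr : nr (z + s%:C *: v - z0) < r / 2.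
    rewrite addrAC; apply: le_lt_trans (nrD _ _) _; rewrite nsv; lra.
  have := holomorphic_lipschitz r0 df fM (w := z) _ zsr.
  rewrite addrAC subrr add0r nsv => /(_ ltac:(lra)); lra.
have r40 : 0 < r / 4 by rewrite divr_gt0.
have := holomorphic_lipschitz r40 phid phiM (w := w) (w' := w') ltac:(lra) ltac:(lra).
have -> : 32 * (32 * M / r * nr v) / (r / 4) * nr (w' - w) =
    4096 * M / r ^+ 2 * nr v * nr (w' - w) by field; rewrite gt_eqF.
have close x dx : nr (s%:C *: v) < dx -> (forall h, nr h < dx ->
    nr (f (x + h) - f x - 'd f x h) <= eta * nr h) ->
    nr (phi x - 'd f x v) <= e / 2.
  move=> svd /(_ _ svd); rewrite linearZ/= nsv => H.
  have -> : phi x - 'd f x v =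
      (s^-1)%:C * (f (x + s%:C *: v) - f x - s%:C *: 'd f x v).
    rewrite mulrBr /phi; congr (_ - _).
    by rewrite -[_ *: _]/(_ * _) mulrA -rmorphM mulVf ?gt_eqF// mul1r.
  rewrite nrM nr_real gtr0_norm ?invr_gt0// ler_pdivrMl//.
  apply: le_trans H _; rewrite mulrCA ler_pM2l//.
  rewrite /eta mulrAC ler_pdivrMr; nra.
have := close w d; rewrite nsv => /(_ sd dP).
have := close w' d'; rewrite nsv => /(_ sd' d'P).
have -> : 'd f w' v - 'd f w v = - (phi w' - 'd f w' v) + (phi w' - phi w)
   + (phi w - 'd f w v) by ring.
have := nrD (- (phi w' - 'd f w' v) + (phi w' - phi w)) (phi w - 'd f w v).
have := nrD (- (phi w' - 'd f w' v)) (phi w' - phi w).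
rewrite nrN; lra.
Qed.

End derivative_bounds.

Section row_vectors.
Context {R : realType} {n : nat}.
Implicit Types v : 'rV[R[i]]_n.

Lemma nr_coord v j : nr (v ord0 j) <= nr v.
Proof.
apply/ler_addgt0Pr => e e0.
have : ball v (nr v + e)%:C 0 by rewrite nr_ballE subr0 ltrDl.
by case=> _ /(_ ord0 j); rewrite mxE nr_ballE subr0 => /ltW.
Qed.

Lemma nr_rV_le v (M : R) : 0 <= M -> (forall j, nr (v ord0 j) <= M) -> nr v <= M.
Proof.
move=> M0 vM; apply/ler_addgt0Pr => e e0.
suff : ball v (M + e)%:C 0 by rewrite nr_ballE subr0 => /ltW.
split=> [|i j]; first by rewrite ltcR; lra.
by rewrite ord1 mxE nr_ballE subr0; have := vM j; lra.
Qed.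

End row_vectors.

Section differential_continuity.
Context {R : realType} {V : normedModType R[i]} {n : nat}.
Variable (F : V -> 'rV[R[i]]_n).

Lemma differentiable_component z j : differentiable F z ->
  differentiable (fun z => F z ord0 j) z.
Proof.
move=> Fz; apply: (@differentiable_comp _ _ _ _ F (fun M : 'rV[R[i]]_n => M ord0 j)).
  exact: Fz.
exact: differentiable_coord.
Qed.

Lemma diff_component z j v : differentiable F z ->
  'd (fun z => F z ord0 j) z v = 'd F z v ord0 j.
Proof.
move=> Fz.
have dc : differentiable (fun M : 'rV[R[i]]_n => M ord0 j) (F z) by exact: differentiable_coord.
rewrite (diff_comp Fz dc) /=.
have @c : {linear 'rV[R[i]]_n -> R[i]}.
  by exists (fun M : 'rV[R[i]]_n => M ord0 j); do 2![eexists]; do ?[constructor];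
    rewrite ?mxE// => ? *; rewrite ?mxE//; move=> ?; rewrite !mxE.
have := @diff_lin _ _ _ c (F z) (@coord_continuous _ _ _ _ _).
by rewrite /= => ->.
Qed.

(** Joint continuity in point and vector, as the derivative ['d F (gamma t) (dg t)] of an image
    curve requires. The dependence on the point is Lipschitz, coordinate by coordinate; the
    dependence on the vector only involves the differential at [z0]. *)
Lemma differential_continuous (D : set V) (z0 v0 : V) : open D ->
  (forall z, D z -> differentiable F z) -> D z0 ->
  forall e : R, 0 < e -> exists2 d : R, 0 < d & forall z v,
    nr (z - z0) < d -> nr (v - v0) < d -> nr ('d F z v - 'd F z0 v0) < e.
Proof.
move=> oD dF Dz0 e e0.
have /nbhs_nrP[r1 r10 r1D] : nbhs z0 D by exact: open_nbhs_nbhs.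
have /cvg_nrP/(_ 1 ltr01) : F z @[z --> z0] --> F z0.
  exact/differentiable_continuous/dF.
move=> /nbhs_nrP[r2 r20 r2F].
have [r [r0 rr1 rr2]] : exists r : R, [/\ 0 < r, r <= r1 & r <= r2].
  by exists (Num.min r1 r2); rewrite lt_min r10 r20 !ge_min !lexx orbT.
have dFj j z : nr (z - z0) < r -> differentiable (fun z => F z ord0 j) z.
  by move=> zr; apply/differentiable_component/dF/r1D/(lt_le_trans zr).
have Fj j z : nr (z - z0) < r -> nr (F z ord0 j) <= nr (F z0) + 1.
  move=> zr; have := r2F z (lt_le_trans zr rr2).
  have -> : F z ord0 j = (F z - F z0) ord0 j + F z0 ord0 j by rewrite !mxE subrK.
  have := nr_coord (F z - F z0) j; have := nr_coord (F z0) j.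
  have := nrD ((F z - F z0) ord0 j) (F z0 ord0 j); lra.
have /choice[L LP] := fun j => differential_lipschitz r0 (dFj j) (Fj j).
(* A common Lipschitz constant for the finitely many coordinates. *)
pose LM := \sum_j `|L j|.
have LLM j : L j <= LM.
  rewrite /LM (bigD1 j)//= (le_trans (ler_norm _))// lerDl.
  by apply: sumr_ge0.
have LM0 : 0 <= LM by apply: sumr_ge0.
have lip z v : nr (z - z0) < r / 8 ->
    nr ('d F z v - 'd F z0 v) <= LM * nr v * nr (z - z0).
  move=> zr; apply: nr_rV_le => [|j]; first by rewrite !mulr_ge0// nr_ge0.
  have dz : differentiable F z by apply/dF/r1D; lra.
  rewrite !mxE -(diff_component j v dz) -(diff_component j v (dF _ Dz0)).
  apply: le_trans (LP j z0 z v _ zr) _; first by rewrite subrr nr0 divr_gt0.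
  by rewrite !ler_wpM2r ?nr_ge0.
have dc : 'd F z0 v @[v --> v0] --> 'd F z0 v0.
  exact: (diff_continuous (dF _ Dz0)).
have e2 : 0 < e / 2 by rewrite divr_gt0.
have /cvg_nrP/(_ _ e2)/nbhs_nrP[d d0 dP] := dc.
pose B := LM * (nr v0 + 1) + 1.
have B0 : 0 < B by rewrite ltr_wpDl// mulr_ge0// addr_ge0// nr_ge0.
exists (Num.min d (Num.min 1 (Num.min (r / 8) (e / (2 * B))))).
  by rewrite !lt_min d0 ltr01 !divr_gt0// mulr_gt0.
move=> z v; rewrite !lt_min => /and4P[_ _ zr ze] /and4P[vd v1 _ _].
have -> : 'd F z v - 'd F z0 v0 = ('d F z v - 'd F z0 v) + ('d F z0 v - 'd F z0 v0).
  by rewrite subrKA.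
apply: le_lt_trans (nrD _ _) _.
have := dP _ vd; have := lip z v zr.
have nv : nr v <= nr v0 + 1.
  by have := nrD (v - v0) v0; rewrite subrK; lra.
have zB : nr (z - z0) * (2 * B) < e by rewrite -ltr_pdivlMr// mulr_gt0.
have := nr_ge0 (z - z0); have := nr_ge0 v => v00 z00.
have : LM * nr v * nr (z - z0) <= B * nr (z - z0).
  rewrite ler_wpM2r// /B; have := ler_wpM2l LM0 nv; lra.
lra.
Qed.

End differential_continuity.

(** * Kobayashi-Royden metric and length *)

Section kobayashi_royden_metric.
Context {R : realType} {n : nat}.
Implicit Types (D : set 'rV[R[i]]_n) (z v : 'rV[R[i]]_n).

Definition candidates D z v : set R :=
  [set r : R | exists lambda : R[i], exists phi : R[i] -> 'rV[R[i]]_n,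
    [/\ holomorphic_on (@unit_disc R) phi,
        forall zeta, unit_disc zeta -> D (phi zeta),
        phi 0 = z, lambda *: derive1 phi 0 = v & r%:C = `|lambda|]].

Lemma candidates_ge0 D z v r : candidates D z v r -> 0 <= r.
Proof. by case=> l [phi [_ _ _ _ rl]]; rewrite -ler0c rl. Qed.

Lemma candidates_has_lbound D z v : has_lbound (candidates D z v).
Proof. by exists 0 => r /candidates_ge0. Qed.

Lemma unit_discE (c : R[i]) : unit_disc c = (nr c < 1) :> Prop.
Proof. by rewrite /unit_disc/= nrE ltcR. Qed.

Lemma kobayashi_royden_ge0 D z v : 0 <= kobayashi_royden D z v.
Proof.
rewrite /kobayashi_royden -/(candidates D z v).
have [[r rS]|/set0P/negP/negPn/eqP ->] := pselect (candidates D z v !=set0).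
  by apply: lb_le_inf; [exists r|move=> s /candidates_ge0].
by rewrite inf0.
Qed.

Lemma derive1_affine z v : derive1 (fun c : R[i] => z + c *: v) 0 = v.
Proof.
rewrite /derive1; apply: cvg_lim => //; apply: cvg_near_cst.
near=> h; have h0 : h != 0 by near: h; exact: nbhs_dnbhs_neq.
by rewrite addr0 scale0r addr0 addrAC subrr add0r scalerA mulVf// scale1r.
Unshelve. all: by end_near. Qed.

(** The affine disc through [z] in the direction of [v]. It also shows that candidates exist, so
    that the infimum is not the default value of [inf] on the empty set. *)
Lemma candidates_ball D z v (r : R) : 0 < r ->
  (forall w, nr (w - z) < r -> D w) -> candidates D z v (nr v / r).
Proof.
move=> r0 rD; pose u := (r / nr v)%:C *: v.
have nu : nr u <= r.
  rewrite nrZr ger0_norm; last by rewrite divr_ge0 ?nr_ge0// ltW.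
  have [->|v0] := eqVneq v 0; first by rewrite nr0 mulr0 ltW.
  by rewrite divfK// gt_eqF// nr_gt0.
exists (nr v / r)%:C, (fun c : R[i] => z + c *: u); split.
- by move=> c _; apply: (differentiable_line (f := id)).
- move=> c; rewrite unit_discE => c1; apply: rD.
  rewrite addrAC subrr add0r nrZ; have := nr_ge0 u; have := nr_ge0 c; nra.
- by rewrite scale0r addr0.
- rewrite derive1_affine /u scalerA -rmorphM/=.
  have [->|v0] := eqVneq v 0; first by rewrite scaler0.
  have nv := nr_gt0 v0.
  by rewrite mulrA divfK ?gt_eqF// divff ?gt_eqF// scale1r.
- by rewrite nrE nr_real ger0_norm// divr_ge0 ?nr_ge0// ltW.
Qed.

Lemma open_ball D z : open D -> D z ->
  exists2 r : R, 0 < r & forall w, nr (w - z) < r -> D w.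
Proof. by move=> oD Dz; apply/nbhs_nrP; exact: open_nbhs_nbhs. Qed.

Lemma kobayashi_royden_ball D z v (r : R) : 0 < r ->
  (forall w, nr (w - z) < r -> D w) -> kobayashi_royden D z v <= nr v / r.
Proof.
by move=> r0 rD; apply: ge_inf; [exact: candidates_has_lbound|exact: candidates_ball].
Qed.

Lemma kobayashi_royden_scale D z v (c : R) : open D -> D z -> 0 < c ->
  kobayashi_royden D z (c%:C *: v) <= c * kobayashi_royden D z v.
Proof.
move=> oD Dz c0; have [r r0 rD] := open_ball oD Dz.
rewrite -ler_pdivrMl//; apply: lb_le_inf.
  by exists (nr v / r); exact: candidates_ball.
move=> s [l [phi [p1 p2 p3 p4 p5]]].
rewrite ler_pdivrMl//; apply: ge_inf; first exact: candidates_has_lbound.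
exists (c%:C * l), phi; split => //; first by rewrite -scalerA p4.
by rewrite rmorphM/= p5 normrM; congr (_ * _); rewrite nrE nr_real gtr0_norm.
Qed.

End kobayashi_royden_metric.

(** Composition with [F] carries a disc in [D1] to a disc in [D2] with the same [lambda]. *)
Lemma kobayashi_royden_holomorphic {R : realType} {n m : nat}
    (D1 : set 'rV[R[i]]_n) (D2 : set 'rV[R[i]]_m) F z v :
  open D1 -> holomorphic_on D1 F -> (forall z, D1 z -> D2 (F z)) -> D1 z ->
  kobayashi_royden D2 (F z) ('d F z v) <= kobayashi_royden D1 z v.
Proof.
move=> oD1 dF FD Dz; have [r r0 rD] := open_ball oD1 Dz.
apply: lb_le_inf; first by exists (nr v / r); exact: candidates_ball.
move=> s [l [phi [p1 p2 p3 p4 p5]]].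
apply: ge_inf; first exact: candidates_has_lbound.
have D0 : @unit_disc R 0 by rewrite unit_discE nr0.
have dphi : differentiable phi 0 by exact: p1.
have dFz : differentiable F (phi 0) by rewrite p3; exact: dF.
have dFphi c : unit_disc c -> differentiable (F \o phi) c.
  move=> c1; apply: differentiable_comp; first exact: p1.
  exact/dF/p2.
exists l, (F \o phi); split => //.
- by move=> c c1; apply: FD; exact: p2.
- by rewrite /= p3.
- rewrite derive1E'; last exact: dFphi.
  rewrite diff_comp// p3 /= -linearZ/= -derive1E'//.
  by rewrite p4.
Qed.

(** * Difference quotients and [C^1] curves *)

Section curves.
Context {R : realType}.
Implicit Types (a b t : R).

Lemma within_cvgP {V : normedModType R[i]} a b t (f : R -> V) l :
  f s @[s --> within `[a, b] (nbhs t)] --> l <->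
  forall e : R, 0 < e -> exists2 d : R, 0 < d &
    forall s, a <= s <= b -> `|s - t| < d -> nr (f s - l) < e.
Proof.
split=> [/cvg_nrP fl e e0|fl].
  have /nbhs_ballP[d d0 dP] := fl e e0; exists d => // s sab sd.
  by apply: dP; rewrite ?in_itv//= /ball/= distrC.
apply/cvg_nrP => e e0; have [d d0 dP] := fl e e0.
apply/nbhs_ballP; exists d => // s; rewrite /ball/= distrC in_itv/= => sd sab.
exact: dP.
Qed.

Lemma within_dnbhs_cvgP {V : normedModType R[i]} a b t (f : R -> V) l :
  f s @[s --> within `[a, b] t^'] --> l <->
  forall e : R, 0 < e -> exists2 d : R, 0 < d &
    forall s, a <= s <= b -> s != t -> `|s - t| < d -> nr (f s - l) < e.
Proof.
split=> [/cvg_nrP fl e e0|fl].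
  have /nbhs_ballP[d d0 dP] := fl e e0; exists d => // s sab st sd.
  by apply: dP; rewrite ?in_itv//= /ball/= distrC.
apply/cvg_nrP => e e0; have [d d0 dP] := fl e e0.
apply/nbhs_ballP; exists d => // s; rewrite /ball/= distrC in_itv/= => sd st sab.
exact: dP.
Qed.

Lemma dnbhs_cvgP {V : normedModType R[i]} t (f : R -> V) l :
  f s @[s --> t^'] --> l <->
  forall e : R, 0 < e -> exists2 d : R, 0 < d &
    forall s, s != t -> `|s - t| < d -> nr (f s - l) < e.
Proof.
split=> [/cvg_nrP fl e e0|fl].
  have /nbhs_ballP[d d0 dP] := fl e e0; exists d => // s st sd.
  by apply: dP => //; rewrite /ball/= distrC.
apply/cvg_nrP => e e0; have [d d0 dP] := fl e e0.
apply/nbhs_ballP; exists d => // s; rewrite /ball/= distrC => sd st.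
exact: dP.
Qed.

Context {n : nat}.
Implicit Types gamma : R -> 'rV[R[i]]_n.

Lemma diff_quotientE gamma t s : s != t ->
  gamma s - gamma t = (s - t)%:C *: diff_quotient gamma t s.
Proof.
move=> st; rewrite /diff_quotient scalerA -rmorphM/= divff ?subr_eq0//.
by rewrite scale1r.
Qed.

Lemma diff_quotient_cvg_continuous gamma t (v : 'rV[R[i]]_n) (G : set_system R) {FG : Filter G} :
  G --> t -> (diff_quotient gamma t s @[s --> G] --> v) ->
  gamma s @[s --> G] --> gamma t.
Proof.
move=> Gt /cvg_nrP/(_ 1 ltr01) Gv; apply/cvg_nrP => e e0.
have v0 := nr_ge0 v.
have e1 : 0 < e / (nr v + 2) by rewrite divr_gt0//; lra.
have Gd : \forall s \near G, `|s - t| < e / (nr v + 2).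
  by apply: Gt; apply/nbhs_ballP; exists (e / (nr v + 2)) => // s; rewrite /ball/= distrC.
apply: filterS2 Gv Gd => s sv st.
have [->|nst] := eqVneq s t; first by rewrite subrr nr0.
rewrite diff_quotientE// nrZr.
have : nr (diff_quotient gamma t s) <= nr v + 2.
  by have := nrD (diff_quotient gamma t s - v) v; rewrite subrK; lra.
move: st; rewrite ltr_pdivlMr; last lra.
have := normr_ge0 (s - t); nra.
Qed.

(** Chain rule along an arbitrary filter at [t]: it covers both the two-sided limit in [velocity]
    and the limits within a segment in [C1_on]. *)
Lemma diff_quotient_comp {m : nat} (F : 'rV[R[i]]_n -> 'rV[R[i]]_m) gamma t
    (v : 'rV[R[i]]_n) (G : set_system R) {FG : Filter G} :
  G --> t -> differentiable F (gamma t) ->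
  (diff_quotient gamma t s @[s --> G] --> v) ->
  diff_quotient (F \o gamma) t s @[s --> G] --> 'd F (gamma t) v.
Proof.
move=> Gt dF Gv; have Gc := diff_quotient_cvg_continuous Gt Gv.
have v0 := nr_ge0 v.
have GL : 'd F (gamma t) (diff_quotient gamma t s) @[s --> G] --> 'd F (gamma t) v.
  apply: (@cvg_comp _ _ _ (diff_quotient gamma t) ('d F (gamma t)) G (nbhs v) _ Gv).
  exact: (diff_continuous dF).
apply/cvg_nrP => e e0.
have e1 : 0 < e / (2 * (nr v + 1)) by rewrite divr_gt0//; lra.
have [d d0 dP] := diff_nrP dF e1.
have e2 : 0 < e / 2 by rewrite divr_gt0.
move/cvg_nrP/(_ _ e2) : GL => GL.
move/(_ FG)/cvg_nrP/(_ _ d0) : Gc => Gc.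
move/cvg_nrP/(_ _ ltr01) : Gv => Gv.
apply: filterS3 GL Gc Gv => s sL sc sv.
(* [G] may not exclude [t]. There both difference quotients vanish, the inverse of 0 being 0, and
   [sL] is already the bound. *)
have [st|st] := eqVneq s t.
  move: sL; rewrite /diff_quotient st !subrr !scaler0 linear0 sub0r.
  by rewrite /= ?subrr ?scaler0 ?sub0r => sL; rewrite (lt_trans sL)//; lra.
have st0 : 0 < `|s - t| by rewrite normr_gt0 subr_eq0.
have := dP _ sc; rewrite [gamma t + _]addrC subrK => H.
set q := diff_quotient gamma t s in sL sv *.
have qE : gamma s - gamma t = (s - t)%:C *: q by rewrite diff_quotientE.
have -> : diff_quotient (F \o gamma) t s - 'd F (gamma t) v =
    ((s - t)^-1)%:C *: (F (gamma s) - F (gamma t) - 'd F (gamma t) (gamma s - gamma t))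
    + ('d F (gamma t) q - 'd F (gamma t) v).
  rewrite qE linearZ/= scalerBr scalerA -rmorphM/= mulVf ?subr_eq0// scale1r.
  by rewrite addrA subrK.
apply: le_lt_trans (nrD _ _) _.
have nq : nr q <= nr v + 1 by have := nrD (q - v) v; rewrite subrK; lra.
suff : nr (((s - t)^-1)%:C *: (F (gamma s) - F (gamma t) -
    'd F (gamma t) (gamma s - gamma t))) <= e / 2 by lra.
rewrite nrZr normfV ler_pdivrMl// (le_trans H)// qE nrZr mulrCA ler_pM2l//.
rewrite mulrAC ler_pdivrMr; nra.
Qed.

Lemma dnbhs_cvg_center t : t^' --> t.
Proof. by move=> A At; rewrite /dnbhs; apply: filterS At. Qed.

Lemma within_dnbhs_cvg_center a b t : within `[a, b] t^' --> t.
Proof. by move=> A At; apply: filterS At. Qed.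

Lemma C1_on_continuous a b gamma : C1_on a b gamma ->
  {within `[a, b], continuous gamma}.
Proof.
case=> dg _ gP; apply/subspace_continuousP => t tab.
have {}tab : t \in `[a, b] by [].
have : gamma s @[s --> within `[a, b] t^'] --> gamma t.
  by apply: diff_quotient_cvg_continuous (gP t tab); exact: within_dnbhs_cvg_center.
move=> /within_dnbhs_cvgP H; apply/within_cvgP => e e0.
have [d d0 dP] := H e e0; exists d => // s sab sd.
by have [->|st] := eqVneq s t; [rewrite subrr nr0|exact: dP].
Qed.

Lemma C1_on_comp {m : nat} (D : set 'rV[R[i]]_n) (F : 'rV[R[i]]_n -> 'rV[R[i]]_m)
    a b gamma : open D -> holomorphic_on D F ->
  (forall t, t \in `[a, b] -> D (gamma t)) ->
  C1_on a b gamma -> C1_on a b (F \o gamma).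
Proof.
move=> oD dF gD C1; have gc := C1_on_continuous C1.
have [dg dgc gP] := C1.
exists (fun t => 'd F (gamma t) (dg t)); last first.
  move=> t tab; apply: diff_quotient_comp; last exact: gP.
    exact: within_dnbhs_cvg_center.
  exact/dF/gD.
apply/subspace_continuousP => t tab; apply/within_cvgP => e e0.
have [d d0 dP] := differential_continuous (dg t) oD dF (gD t tab) e0.
move/subspace_continuousP/(_ t tab)/within_cvgP/(_ d d0) : gc => [d1 d10 d1P].
move/subspace_continuousP/(_ t tab)/within_cvgP/(_ d d0) : dgc => [d2 d20 d2P].
exists (Num.min d1 d2); first by rewrite lt_min d10.
by move=> s sab; rewrite lt_min => /andP[s1 s2]; apply: dP; [exact: d1P|exact: d2P].
Qed.

Lemma C1_on_sub a b c d gamma : a <= c -> d <= b ->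
  C1_on a b gamma -> C1_on c d gamma.
Proof.
move=> ac db [dg dgc gP].
have sub t : t \in `[c, d] -> t \in `[a, b].
  by rewrite !in_itv/= => /andP[ct td]; rewrite (le_trans ac)//= (le_trans td).
exists dg; first by apply: continuous_subspaceW dgc => t /sub.
move=> t /sub/gP/within_dnbhs_cvgP H; apply/within_dnbhs_cvgP => e /H[r r0 rP].
exists r => // s /andP[cs sd]; apply: rP.
by rewrite (le_trans ac)//= (le_trans sd).
Qed.

End curves.

(** An inductive form of [piecewise_C1_on], which replaces the indices of a partition by induction
    on the pieces. *)
Inductive piecewise {R : realType} {n : nat} (gamma : R -> 'rV[R[i]]_n) : R -> R -> Prop :=
| piecewise_nil a : piecewise gamma a a
| piecewise_cons a x b : a < x -> C1_on a x gamma -> piecewise gamma x b ->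
    piecewise gamma a b.

Section piecewise_curves.
Context {R : realType} {n : nat}.
Implicit Types (a b t : R) (gamma : R -> 'rV[R[i]]_n).

Lemma piecewiseP a b gamma : piecewise_C1_on a b gamma <-> piecewise gamma a b.
Proof.
split.
  case=> s; elim: s a => [a /itv_partition_nil -> _|x s IH a [/= /andP[ax xs] sb] H].
    exact: piecewise_nil.
  apply: (@piecewise_cons _ _ _ a x) => //; first exact: (H 0%N).
  by apply: IH => [|i si]; [split|exact: (H i.+1)].
elim=> [{}a|{}a x {}b ax C1 _ [s [xs sb] H]].
  by exists [::] => //; split => /=.
exists (x :: s); first by split=> /=; [rewrite ax|].
by case=> [_|i]; [exact: C1|exact: H].
Qed.

Lemma piecewise_le a b gamma : piecewise gamma a b -> a <= b.
Proof. by elim=> // {}a x {}b ax _ _; apply: le_trans; exact: ltW. Qed.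

Lemma piecewise_right a b c gamma : piecewise gamma a b -> a <= c <= b ->
  piecewise gamma c b.
Proof.
elim=> [{}a|{}a x {}b ax C1 xb IH /andP[ac cb]].
  by rewrite -eq_le => /eqP ->; exact: piecewise_nil.
have [xc|cx] := leP x c; first by apply: IH; rewrite xc.
by apply: piecewise_cons cx _ xb; exact: C1_on_sub C1.
Qed.

Lemma piecewise_left a b c gamma : piecewise gamma a b -> a <= c <= b ->
  piecewise gamma a c.
Proof.
elim=> [{}a|{}a x {}b ax C1 xb IH /andP[ac cb]].
  by rewrite -eq_le => /eqP ->; exact: piecewise_nil.
have [xc|cx] := leP x c.
  by apply: piecewise_cons ax C1 _; apply: IH; rewrite xc.
have [->|ac'] := eqVneq a c; first exact: piecewise_nil.
apply: (@piecewise_cons _ _ _ a c) => //; last exact: piecewise_nil.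
  by rewrite lt_neqAle ac'.
by apply: C1_on_sub C1 => //; exact: ltW.
Qed.

Lemma piecewise_comp {m : nat} (D : set 'rV[R[i]]_n) (F : 'rV[R[i]]_n -> 'rV[R[i]]_m)
    a b gamma : open D -> holomorphic_on D F ->
  (forall t, t \in `[a, b] -> D (gamma t)) ->
  piecewise gamma a b -> piecewise (F \o gamma) a b.
Proof.
move=> oD dF + P; elim: P => [{}a _|{}a x {}b ax C1 xb IH gD].
  exact: piecewise_nil.
have xb' := piecewise_le xb.
apply: (@piecewise_cons _ _ _ a x) => //.
  apply: C1_on_comp dF _ C1 => // t; rewrite in_itv/= => /andP[ta tx].
  by apply: gD; rewrite in_itv/= ta (le_trans tx).
apply: IH => t; rewrite in_itv/= => /andP[ta tx].
by apply: gD; rewrite in_itv/= tx (le_trans (ltW ax)).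
Qed.

(** [velocity] is a two-sided limit while [C1_on] is one-sided at the ends, so [S] collects the ends
    of all pieces, [a] and [b] included. *)
Lemma piecewise_velocity a b gamma : piecewise gamma a b ->
  exists S : set R, finite_set S /\ forall t, a <= t <= b -> ~ S t ->
    cvg (diff_quotient gamma t s @[s --> t^']).
Proof.
elim=> [{}a|{}a x {}b ax [dg _ gP] xb [S [fS SP]]].
  exists [set a]; split; first exact: finite_set1.
  by move=> t; rewrite -eq_le => /eqP -> /(_ erefl).
exists (S `|` [set a; x]); split.
  by rewrite finite_setU; split => //; exact: finite_set2.
move=> t /andP[ta tb] /not_orP[St /not_orP[tna tnx]].
have [xt|tx] := leP x t; first by apply: SP => //; rewrite xt.
apply/cvg_ex; exists (dg t).
have := gP t; rewrite in_itv/= ta (ltW tx) => /(_ isT)/within_dnbhs_cvgP H.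
apply/dnbhs_cvgP => e e0; have [d d0 dP] := H e e0.
have at' : a < t by rewrite lt_neqAle ta andbT; apply/eqP => E; apply: tna.
exists (Num.min d (Num.min (t - a) (x - t))).
  by rewrite !lt_min d0 !subr_gt0 at'.
move=> s st; rewrite !lt_min => /and3P[sd sa sx]; apply: dP => //.
by move: sa sx; rewrite !ltr_norml => /andP[? ?] /andP[? ?]; apply/andP; split; lra.
Qed.

End piecewise_curves.

(* The integral of a nonnegative function that is not known to be measurable is
   the supremum of the integrals of the simple functions below it. *)
Section lower_integral.
Context {R : realType}.
Local Notation mu := (@lebesgue_measure R).
Local Open Scope ereal_scope.
Implicit Types (f g : R -> \bar R) (A B D S : set R).
Import HBNNSimple.

Lemma lower_integral_le D f c : (forall x, D x -> 0 <= f x) ->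
  (forall h : {nnsfun (measurableTypeR R) >-> R}, (forall x, (h x)%:E <= (f \_ D) x) ->
    \int[mu]_x (h x)%:E <= c) ->
  \int[mu]_(x in D) f x <= c.
Proof.
move=> f0 hc; rewrite ge0_integralE//; apply: ge_ereal_sup => _ [h hf <-].
by rewrite -integralT_nnsfun; exact: hc.
Qed.

Lemma lower_integral_mono A D f g : (forall x, A x -> 0 <= g x) ->
  (forall x, D x -> 0 <= f x) -> (forall x, (g \_ A) x <= (f \_ D) x) ->
  \int[mu]_(x in A) g x <= \int[mu]_(x in D) f x.
Proof.
move=> g0 f0 gf; rewrite ge0_integralE// [leRHS]ge0_integralE//.
apply: le_ereal_sup => _ [h hg <-]; exists h => // x.
exact: le_trans (hg x) (gf x).
Qed.

Lemma finite_set_null S : finite_set S ->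
  measurable (S : set (measurableTypeR R)) /\ mu S = 0.
Proof.
move=> fS; split.
  apply: countable_measurable; last exact: finite_set_countable.
  by move=> x; exact: measurable_set1.
exact/countable_lebesgue_measure0/finite_set_countable.
Qed.

(** Neither [f] nor [g] is assumed measurable, so the null set is discarded from the simple
    functions below [f]. *)
Lemma lower_integral_le_off_finite D f g S : finite_set S ->
  (forall x, D x -> 0 <= f x) -> (forall x, D x -> 0 <= g x) ->
  (forall x, D x -> ~ S x -> f x <= g x) ->
  \int[mu]_(x in D) f x <= \int[mu]_(x in D) g x.
Proof.
move=> /finite_set_null[mS S0] f0 g0 fg; apply: lower_integral_le => // h hf.
rewrite (@ge0_negligible_integral _ _ _ mu setT S)//; last 2 first.
- exact/measurable_EFinP/measurable_funP.
- by move=> x _; rewrite lee_fin.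
apply: lower_integral_mono => // [x _|x]; first by rewrite lee_fin.
rewrite /patch; case: ifPn => [|_]; last first.
  by case: ifPn => // /[!inE] /g0.
rewrite inE => -[_ Sx]; have := hf x; rewrite /patch; case: ifPn => // /[!inE] Dx.
by move=> /le_trans; apply; exact: fg.
Qed.

(** A simple function below [f] on [A] and one below [f] on [B] add up to a simple function below
    [f] on the union, since at each point one of them vanishes. *)
Lemma lower_integral_superadditive A B f : A `&` B = set0 ->
  (forall x, (A `|` B) x -> 0 <= f x) ->
  \int[mu]_(x in A) f x + \int[mu]_(x in B) f x <= \int[mu]_(x in A `|` B) f x.
Proof.
move=> AB f0; set c := leRHS.
have fA x : A x -> 0 <= f x by move=> Ax; apply: f0; left.
have fB x : B x -> 0 <= f x by move=> Bx; apply: f0; right.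
have c0 : 0 <= c by apply: integral_ge0.
(* With [c] finite, each term can be moved across the inequality, and the two suprema are bounded
   one after the other. *)
have [->|cfin] := eqVneq c +oo; first by rewrite leey.
have {}cfin : c \is a fin_num by rewrite ge0_fin_numE// ltey.
have Bc : \int[mu]_(x in B) f x <= c.
  apply: lower_integral_mono => // x; rewrite /patch.
  case: ifPn => [/[!inE] Bx|_].
    by rewrite ifT// inE; right.
  by case: ifPn => // /[!inE] /f0.
have B0 : 0 <= \int[mu]_(x in B) f x by apply: integral_ge0.
have Bfin : \int[mu]_(x in B) f x \is a fin_num.
  by rewrite ge0_fin_numE// (le_lt_trans Bc)// ltey_eq cfin.
rewrite -leeBrDr//; apply: lower_integral_le => // h1 h1f.
have h10 : 0 <= \int[mu]_x (h1 x)%:E by apply: integral_ge0 => x _; rewrite lee_fin.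
have h1c : \int[mu]_x (h1 x)%:E <= c.
  apply: lower_integral_mono => // [x _|x]; first by rewrite lee_fin.
  rewrite patch_setT; apply: le_trans (h1f x) _; rewrite /patch.
  case: ifPn => [/[!inE] Bx|_].
    by rewrite ifT// inE; left.
  by case: ifPn => // /[!inE] /f0.
have h1fin : \int[mu]_x (h1 x)%:E \is a fin_num.
  by rewrite ge0_fin_numE// (le_lt_trans h1c)// ltey_eq cfin.
rewrite leeBrDr// addeC -leeBrDr//; apply: lower_integral_le => // h2 h2f.
rewrite leeBrDr// -ge0_integralD//; last 4 first.
- by move=> x _; rewrite lee_fin.
- exact/measurable_EFinP/measurable_funP.
- by move=> x _; rewrite lee_fin.
- exact/measurable_EFinP/measurable_funP.
apply: lower_integral_mono => // [x _|x].
  by rewrite adde_ge0// lee_fin.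
rewrite patch_setT; have := h1f x; have := h2f x; rewrite /patch.
have hh1 : 0 <= (h1 x)%:E by rewrite lee_fin.
have hh2 : 0 <= (h2 x)%:E by rewrite lee_fin.
case: ifPn => [/[!inE] Bx|_].
  rewrite ifF; last first.
    apply/negbTE/negP; rewrite inE => Ax.
    by have : (A `&` B) x by []; rewrite AB.
  rewrite ifT; last by rewrite inE; right.
  by move=> h2x h1x; rewrite -[leRHS]adde0 leeD.
case: ifPn => [/[!inE] Ax|_].
  rewrite ifT; last by rewrite inE; left.
  by move=> h2x h1x; rewrite -[leRHS]add0e leeD.
move=> h2x h1x; case: ifPn => [/[!inE] /f0 fx|_].
  apply: le_trans fx; rewrite -[leRHS]adde0 leeD//.
by rewrite -[leRHS]adde0 leeD.
Qed.

(** Lebesgue measure is [b^-1] times its image under [psi]; by uniqueness this is checked on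
    half-open intervals. *)
Lemma integral_affine (h : {nnsfun (measurableTypeR R) >-> R}) (a b : R) : (0 < b)%R ->
  \int[mu]_x (h x)%:E = \int[mu]_x (b^-1 * h ((x - a) / b))%:E.
Proof.
move=> b0; pose psi (x : measurableTypeR R) : measurableTypeR R := ((x - a) / b)%R.
have mpsi : measurable_fun setT psi.
  by apply: measurable_funM => //; apply: measurable_funB.
have bi0 : (0 <= b^-1)%R by rewrite invr_ge0 ltW.
pose bi : {nonneg R} := NngNum bi0.
have mh : measurable_fun setT (fun x => (h x)%:E).
  exact/measurable_EFinP/measurable_funP.
have h0 x : 0 <= (h x)%:E by rewrite lee_fin.
have E := @ge0_integral_pushforward _ _ _ _ _ psi mpsi mu setT (EFin \o h)
  measurableT mh (fun x _ => h0 x).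
transitivity (bi%:num%:E * \int[mu]_(x in psi @^-1` setT) (EFin \o h \o psi) x).
  rewrite -E -ge0_integral_mscale//; last by move=> x _; exact: h0.
  apply: eq_measure_integral => A mA _.
  apply: lebesgue_measure_unique => // _ [[x y] /= _ <-].
  rewrite /mscale/= /pushforward.
  have -> : psi @^-1` `]x, y] = `](a + b * x)%R, (a + b * y)%R]%classic.
    apply/seteqP; split=> z; rewrite /= !in_itv/= /psi ltr_pdivlMr// ler_pdivrMr//.
      by move=> /andP[? ?]; apply/andP; split; lra.
    by move=> /andP[? ?]; apply/andP; split; lra.
  rewrite !lebesgue_measure_itv/= !lte_fin ltrD2l ltr_pM2l//.
  case: ifPn => _; last by rewrite mule0.
  rewrite -!EFinD -EFinM; congr (_%:E); field; exact: lt0r_neq0.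
rewrite preimage_setT -ge0_integralZl//=.
exact: (measurableT_comp mh).
Qed.

(** The substitution [x = a + (b - a) * u], done on the simple functions below [g]. The interval on
    the side of [f] is open so that adjacent pieces of a curve have disjoint domains. *)
Lemma lower_integral_affine (a b : R) f g S : (a < b)%R -> finite_set S ->
  (forall x, x \in `]a, b[ -> 0 <= f x) ->
  (forall x, x \in `[0%R, 1%R] -> 0 <= g x) ->
  (forall u, u \in `]0%R, 1%R[ -> ~ S (a + (b - a) * u)%R ->
     g u <= (b - a)%:E * f (a + (b - a) * u)%R) ->
  \int[mu]_(x in `[0%R, 1%R]) g x <= \int[mu]_(x in `]a, b[) f x.
Proof.
move=> ab fS f0 g0 gf; apply: lower_integral_le => // h hg.
have ba : (0 < b - a)%R by rewrite subr_gt0.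
rewrite (integral_affine h a ba).
have [mN N0] : measurable (S `|` [set a; b] : set (measurableTypeR R)) /\ mu (S `|` [set a; b]) = 0.
  by apply: finite_set_null; rewrite finite_setU; split => //; exact: finite_set2.
rewrite (@ge0_negligible_integral _ _ _ mu setT (S `|` [set a; b]))//; last 2 first.
- apply/measurable_EFinP; apply: measurable_funM => //.
  apply: (@measurableT_comp _ _ _ _ _ _ h) => //.
  by apply: measurable_funM => //; apply: measurable_funB.
- by move=> x _; rewrite lee_fin mulr_ge0// invr_ge0 ltW.
apply: lower_integral_mono => [x _|x|x].
- by rewrite lee_fin mulr_ge0// invr_ge0 ltW.
- by move=> /= xab; exact: f0.
rewrite /patch; case: ifPn => [/[!inE] -[_ /not_orP[Sx /not_orP[xa xb]]]|_]; last first.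
  by case: ifPn => // /[!inE] xab; exact: f0.
have ub : x = (a + (b - a) * ((x - a) / (b - a)))%R.
  by field; rewrite subr_eq0 gt_eqF.
set u := ((x - a) / (b - a))%R in ub *.
have := hg u; rewrite /patch.
have [u01|u01] := boolP (u \in `[0%R, 1%R]); last first.
  rewrite ifF; last by apply/negbTE; rewrite notin_setE/=; exact/negP.
  rewrite lee_fin => hu.
  have -> : h u = 0%R by apply/eqP; rewrite eq_le hu/=.
  by rewrite mulr0; case: ifPn => // /[!inE]; exact: f0.
rewrite ifT ?inE// => hu.
have xab : x \in `]a, b[.
  move: u01; rewrite !in_itv/= /u ler_pdivrMr// ler_pdivlMr// => /andP[ax xb'].
  have xa' : x != a by apply/eqP.
  have xb'' : x != b by apply/eqP.
  by rewrite !lt_neqAle eq_sym xa' xb''/=; apply/andP; split; lra.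
rewrite ifT ?inE//.
have u0 : u \in `]0%R, 1%R[.
  move: xab; rewrite !in_itv/= /u ltr_pdivrMr// ltr_pdivlMr// => /andP[ax xb'].
  by apply/andP; split; lra.
have := gf u u0; rewrite -ub => /(_ Sx) gu.
have := le_trans hu gu.
rewrite EFinM => hf; rewrite -(@lee_pmul2l _ (b - a)%:E)//.
by rewrite -!EFinM mulrA divff ?gt_eqF// mul1r.
Qed.

End lower_integral.

(** * Affine reparametrization of curves *)

Section reparametrization.
Context {R : realType} {n : nat}.
Implicit Types (a b t c : R) (gamma : R -> 'rV[R[i]]_n).
Variables (c b : R) (b0 : 0 < b).

Let phi (u : R) := c + b * u.

Let phiB s u : phi s - phi u = b * (s - u).
Proof. by rewrite /phi; ring. Qed.

Lemma diff_quotient_affine gamma t s :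
  diff_quotient (gamma \o phi) t s = b%:C *: diff_quotient gamma (phi t) (phi s).
Proof.
rewrite /diff_quotient /= phiB scalerA -rmorphM/= invfM mulrA divff ?mul1r//.
by rewrite gt_eqF.
Qed.

Let phi_le s u d : 0 < d -> (`|s - u| < d / b) = (`|phi s - phi u| < d).
Proof.
by move=> d0; rewrite phiB normrM gtr0_norm// ltr_pdivlMr// mulrC.
Qed.

Lemma C1_on_affine x y gamma : C1_on x y gamma ->
  C1_on ((x - c) / b) ((y - c) / b) (gamma \o phi).
Proof.
case=> dg dgc gP.
have itvP u : (x - c) / b <= u <= (y - c) / b = (x <= phi u <= y).
  rewrite ler_pdivrMr// ler_pdivlMr// /phi.
  by congr (_ && _); [rewrite lerBlDl|rewrite lerBrDl]; rewrite [u * b]mulrC.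
exists (fun u => b%:C *: dg (phi u)).
  apply/subspace_continuousP => u; rewrite /= in_itv/= itvP => uxy.
  have : phi u \in `[x, y] by rewrite in_itv.
  move/subspace_continuousP : dgc => /[apply] /within_cvgP H.
  apply/within_cvgP => e e0.
  have [d d0 dP] := H (e / b) (divr_gt0 e0 b0).
  exists (d / b); first exact: divr_gt0.
  move=> s; rewrite itvP phi_le// => sxy sd.
  by rewrite -scalerBr nrZr gtr0_norm// -ltr_pdivlMl// mulrC; exact: dP.
move=> u; rewrite in_itv/= itvP => uxy.
have /gP/within_dnbhs_cvgP H : phi u \in `[x, y] by rewrite in_itv.
apply/within_dnbhs_cvgP => e e0; have [d d0 dP] := H (e / b) (divr_gt0 e0 b0).
exists (d / b); first exact: divr_gt0.
move=> s; rewrite itvP phi_le// => sxy su sd.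
rewrite diff_quotient_affine -scalerBr nrZr gtr0_norm// -ltr_pdivlMl// mulrC.
apply: dP => //; rewrite -subr_eq0 phiB mulf_neq0 ?subr_eq0//.
by rewrite gt_eqF.
Qed.

Lemma piecewise_affine x y gamma : piecewise gamma x y ->
  piecewise (gamma \o phi) ((x - c) / b) ((y - c) / b).
Proof.
elim=> [a|a z a' az C1 _ IH]; first exact: piecewise_nil.
apply: piecewise_cons IH; last exact: C1_on_affine.
by rewrite ltr_pM2r ?invr_gt0// ltrD2r.
Qed.

Lemma velocity_affine gamma u : cvg (diff_quotient gamma (phi u) s @[s --> (phi u)^']) ->
  velocity (gamma \o phi) u = b%:C *: velocity gamma (phi u).
Proof.
move=> gu; rewrite /velocity; apply: cvg_lim; first exact: norm_hausdorff.
move/dnbhs_cvgP : gu => H.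
apply/dnbhs_cvgP => e e0; have [d d0 dP] := H (e / b) (divr_gt0 e0 b0).
exists (d / b); first exact: divr_gt0.
move=> s su; rewrite phi_le// => sd.
rewrite diff_quotient_affine -scalerBr nrZr gtr0_norm// -ltr_pdivlMl// mulrC.
apply: dP => //; rewrite -subr_eq0 phiB mulf_neq0 ?subr_eq0//.
by rewrite gt_eqF.
Qed.

End reparametrization.

(** * Kobayashi distance *)

Section kobayashi_distance.
Context {R : realType} {n : nat}.
Implicit Types (D : set 'rV[R[i]]_n) (z w : 'rV[R[i]]_n) (gamma : R -> 'rV[R[i]]_n).
Local Notation mu := (@lebesgue_measure R).

Definition curve_in D gamma : Prop :=
  piecewise gamma 0 1 /\ forall t : R, t \in `[0, 1] -> D (gamma t).

Let integrand D gamma t : \bar R := (kobayashi_royden D (gamma t) (velocity gamma t))%:E.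

Let integrand_ge0 D gamma t : (0 <= integrand D gamma t)%E.
Proof. by rewrite lee_fin kobayashi_royden_ge0. Qed.

Lemma kobayashi_length_ge0 D gamma : (0 <= kobayashi_length D gamma)%E.
Proof. by apply: integral_ge0 => t _; exact: integrand_ge0. Qed.

Let lengths D z w := [set kobayashi_length D gamma | gamma in
    [set gamma : R -> 'rV[R[i]]_n |
      [/\ piecewise_C1_on 0 1 gamma, forall t : R, t \in `[0, 1] -> D (gamma t),
          gamma 0 = z & gamma 1 = w]]].

Let lengths_ge0 D z w : (0 <= ereal_inf (lengths D z w))%E.
Proof.
by apply: le_ereal_inf_tmp => _ [gamma _ <-]; exact: kobayashi_length_ge0.
Qed.

Lemma kobayashi_dist_le_length D gamma : curve_in D gamma ->
  ((kobayashi_dist D (gamma 0) (gamma 1))%:E <= kobayashi_length D gamma)%E.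
Proof.
case=> /piecewiseP gp gD.
rewrite /kobayashi_dist -/(lengths D (gamma 0) (gamma 1)).
have : (ereal_inf (lengths D (gamma 0%R) (gamma 1%R)) <= kobayashi_length D gamma)%E.
  by apply: ereal_inf_lbound; exists gamma.
have := lengths_ge0 D (gamma 0) (gamma 1).
case: (ereal_inf _) => [r|_ _|//] //=.
exact: kobayashi_length_ge0.
Qed.

(** [fine] would turn an infinite infimum of lengths into 0, which separation forbids for [z <> w].
    So the infimum is finite, and curves from [z] to [w] exist. *)
Lemma kobayashi_dist_curve D z w (e : R) : is_distance_on D (kobayashi_dist D) ->
  D z -> D w -> z <> w -> 0 < e -> exists gamma, [/\ curve_in D gamma,
    gamma 0 = z, gamma 1 = w &
    (kobayashi_length D gamma <= (kobayashi_dist D z w + e)%:E)%E].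
Proof.
case=> _ d0 _ _ Dz Dw zw e0.
have fin : ereal_inf (lengths D z w) \is a fin_num.
  rewrite ge0_fin_numE ?lengths_ge0// ltey; apply/eqP => E.
  by apply/zw/(d0 _ _ Dz Dw); rewrite /kobayashi_dist -/(lengths D z w) E.
have [_ [gamma [/piecewiseP gp gD g0 g1] <-]] := lb_ereal_inf_adherent e0 fin.
move=> lt; exists gamma; split => //.
by rewrite EFinD /kobayashi_dist -/(lengths D z w) fineK// ltW.
Qed.

Lemma kobayashi_dist_subcurve D gamma a b : open D -> curve_in D gamma ->
  0 <= a -> a < b -> b <= 1 ->
  ((kobayashi_dist D (gamma a) (gamma b))%:E <=
    \int[mu]_(t in `]a, b[) integrand D gamma t)%E.
Proof.
move=> oD [gp gD] a0 ab b1.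
have ba : 0 < b - a by rewrite subr_gt0.
pose phi (u : R) := a + (b - a) * u.
have phi0 : gamma a = (gamma \o phi) 0 by rewrite /= /phi mulr0 addr0.
have phi1 : gamma b = (gamma \o phi) 1 by rewrite /= /phi mulr1 addrC subrK.
have phiP u : u \in `[0, 1] -> a <= phi u <= b.
  by rewrite in_itv/= /phi => /andP[u0 u1]; apply/andP; split; nra.
rewrite phi0 phi1; apply: le_trans (kobayashi_dist_le_length _) _.
  split; last first.
    move=> u /phiP/andP[? ?]; apply: gD; rewrite in_itv/=; apply/andP; split; lra.
  have gab : piecewise gamma a b.
    have ga1 : piecewise gamma a 1 by apply: piecewise_right gp _; apply/andP; split; lra.
    by apply: piecewise_left ga1 _; apply/andP; split; lra.
  have := piecewise_affine a ba gab.
  by rewrite subrr mul0r divff// gt_eqF.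
have [S [fS SP]] := piecewise_velocity gp.
apply: (lower_integral_affine ab fS) => [u _|u _|u u01 Su].
- exact: integrand_ge0.
- exact: integrand_ge0.
have uab : a <= phi u <= b.
  by apply: phiP; move: u01; rewrite !in_itv/= => /andP[? ?]; apply/andP; split; lra.
have Dphi : D (gamma (phi u)).
  by apply: gD; rewrite in_itv/=; move: uab => /andP[? ?]; apply/andP; split; lra.
rewrite -EFinM lee_fin velocity_affine//; last first.
  apply: SP; last exact: Su.
  by move: uab; rewrite /phi => /andP[? ?]; apply/andP; split; lra.
exact: kobayashi_royden_scale.
Qed.

(** Superadditivity over []0, a[], []a, b[] and []b, 1[]. It is the source of points almost between
    two others; a division into two pieces is the case [a = b]. *)
Lemma kobayashi_dist_three D gamma a b (L : R) : open D ->
  is_distance_on D (kobayashi_dist D) -> curve_in D gamma ->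
  0 <= a -> a <= b -> b <= 1 -> (kobayashi_length D gamma <= L%:E)%E ->
  kobayashi_dist D (gamma 0) (gamma a) + kobayashi_dist D (gamma a) (gamma b)
    + kobayashi_dist D (gamma b) (gamma 1) <= L.
Proof.
move=> oD dD gD a0 ab b1 gL; rewrite -lee_fin; apply: le_trans gL.
have sub x y : 0 <= x -> x <= y -> y <= 1 ->
  ((kobayashi_dist D (gamma x) (gamma y))%:E <=
    \int[mu]_(t in `]x, y[) integrand D gamma t)%E.
  move=> x0; rewrite le_eqVlt => /predU1P[<- x1|xy y1]; last first.
    exact: kobayashi_dist_subcurve.
  have Dx : D (gamma x) by apply: gD.2; rewrite in_itv/= x0.
  have [_ d0 _ _] := dD; rewrite (d0 _ _ Dx Dx).2//.
  by apply: integral_ge0 => t _; exact: integrand_ge0.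
rewrite !EFinD.
have b0 : 0 <= b by apply: le_trans ab.
have a1 : a <= 1 by apply: le_trans b1.
apply: le_trans (leeD
  (leeD (sub 0 a (lexx _) a0 a1) (sub a b a0 ab b1)) (sub b 1 b0 b1 (lexx _))) _.
have dis1 : `]0, a[ `&` `]a, b[ = set0 :> set R.
  by apply/seteqP; split => // x; rewrite /= !in_itv/= => -[/andP[_ ?] /andP[? _]]; lra.
have dis2 : (`]0, a[ `|` `]a, b[) `&` `]b, 1[ = set0 :> set R.
  by apply/seteqP; split => // x; rewrite /= !in_itv/= => -[[|] /andP[_ ?] /andP[? _]]; lra.
have nn A : forall x, A x -> (0 <= integrand D gamma x)%E.
  by move=> x _; exact: integrand_ge0.
apply: le_trans (leeD2r _ (lower_integral_superadditive dis1 (nn _))) _.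
apply: le_trans (lower_integral_superadditive dis2 (nn _)) _.
apply: lower_integral_mono; try exact: nn.
move=> x; rewrite /patch; case: ifPn => [/[!inE] xab|_].
  rewrite ifT// inE/= in_itv/=; move: xab; rewrite /= !in_itv/=.
  by move=> [[|]|] /andP[? ?]; apply/andP; split; lra.
by case: ifPn => // _; exact: integrand_ge0.
Qed.

End kobayashi_distance.

Section kobayashi_distance_estimates.
Context {R : realType} {n : nat}.
Implicit Types (D : set 'rV[R[i]]_n) (z w : 'rV[R[i]]_n).

(** The images of almost shortest curves are admissible by [piecewise_comp], and off the break
    points their integrand is no larger. *)
Lemma kobayashi_dist_holomorphic {m : nat} D1 (D2 : set 'rV[R[i]]_m) F z w :
  open D1 -> is_distance_on D1 (kobayashi_dist D1) ->
  is_distance_on D2 (kobayashi_dist D2) -> holomorphic_on D1 F ->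
  (forall z, D1 z -> D2 (F z)) -> D1 z -> D1 w ->
  kobayashi_dist D2 (F z) (F w) <= kobayashi_dist D1 z w.
Proof.
move=> oD1 dD1 dD2 dF FD Dz Dw.
have [d1_ge0 _ _ _] := dD1; have [_ d2_0 _ _] := dD2.
have [->|/eqP zw] := eqVneq z w.
  by rewrite (d2_0 _ _ (FD _ Dw) (FD _ Dw)).2// d1_ge0.
apply/ler_addgt0Pr => e e0.
have [gamma [[gp gD] <- <- gL]] := kobayashi_dist_curve dD1 Dz Dw zw e0.
rewrite -lee_fin; apply: le_trans gL.
have cF : curve_in D2 (F \o gamma).
  by split; [exact: piecewise_comp dF gD gp|move=> t /gD; exact: FD].
apply: le_trans (kobayashi_dist_le_length cF) _.
have [S [fS SP]] := piecewise_velocity gp.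
apply: (lower_integral_le_off_finite fS) => [t _|t _|t t01 St].
- by rewrite lee_fin kobayashi_royden_ge0.
- by rewrite lee_fin kobayashi_royden_ge0.
rewrite lee_fin.
have -> : velocity (F \o gamma) t = 'd F (gamma t) (velocity gamma t).
  apply: cvg_lim; first exact: norm_hausdorff.
  apply: diff_quotient_comp; [exact: dnbhs_cvg_center|exact/dF/gD|].
  by apply: SP => //; rewrite -in_itv.
by apply: kobayashi_royden_holomorphic dF FD _ => //; exact: gD.
Qed.

(** Each point of the straight segment is the centre of a ball of radius [r / 2] inside [D], which
    bounds the metric along it. *)
Lemma kobayashi_dist_ball D z0 (r : R) : 0 < r ->
  (forall w, nr (w - z0) < r -> D w) ->
  forall z w, nr (z - z0) < r / 2 -> nr (w - z0) < r / 2 ->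
  kobayashi_dist D z w <= 2 / r * nr (w - z).
Proof.
move=> r0 rD z w zr wr; pose gamma (t : R) := z + t%:C *: (w - z).
have g0 : gamma 0 = z by rewrite /gamma scale0r addr0.
have g1 : gamma 1 = w by rewrite /gamma scale1r addrC subrK.
have dq (t s : R) : s != t -> diff_quotient gamma t s = w - z.
  move=> st; rewrite /diff_quotient /gamma addrAC opprD addrA subrr add0r.
  rewrite addrC -scalerBl -rmorphB scalerA -rmorphM/= mulVf ?scale1r//.
  by rewrite subr_eq0.
have vel t : velocity gamma t = w - z.
  apply: cvg_lim; first exact: norm_hausdorff.
  apply/dnbhs_cvgP => e e0; exists 1 => // s st _.
  by rewrite dq// subrr nr0.
have gr (t : R) : 0 <= t <= 1 -> nr (gamma t - z0) < r / 2.
  by move=> t01; exact: nr_convex.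
have C1 : C1_on 0 1 gamma.
  exists (fun=> w - z).
    by apply: continuous_subspaceT => x; exact: cvg_cst.
  move=> t _; apply/within_dnbhs_cvgP => e e0; exists 1 => // s _ st _.
  by rewrite dq// subrr nr0.
have cD : curve_in D gamma.
  split; first by apply: piecewise_cons C1 _ => //; exact: piecewise_nil.
  by move=> t; rewrite in_itv/= => /gr gt; apply: rD; lra.
have := kobayashi_dist_le_length cD; rewrite g0 g1 -lee_fin.
move=> /le_trans; apply.
apply: (@le_trans _ _ (\int[lebesgue_measure]_(t in `[0%R, 1%R]) (2 / r * nr (w - z))%:E)%E).
  apply: (lower_integral_le_off_finite (@finite_set0 R)) => [t _|t _|t + _].
  - by rewrite lee_fin kobayashi_royden_ge0.
  - by rewrite lee_fin mulr_ge0 ?nr_ge0// divr_ge0// ltW.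
  rewrite /= in_itv/= => /gr gt; rewrite lee_fin vel.
  have -> : 2 / r * nr (w - z) = nr (w - z) / (r / 2) by field; rewrite gt_eqF.
  apply: kobayashi_royden_ball; first by rewrite divr_gt0.
  move=> x xg; apply: rD; have := nr_triangle (gamma t) x z0; lra.
by rewrite integral_cst//= lebesgue_measure_itv/= lte_fin ltr01 sube0 mule1.
Qed.

End kobayashi_distance_estimates.

(** * Ultralimits *)

Section ultralimits.

Lemma ultra_fmap (T U : Type) (f : T -> U) (G : set_system T) :
  UltraFilter G -> UltraFilter (f @ G).
Proof.
move=> UG; apply: Build_UltraFilter => H PH GH.
apply/seteqP; split=> A; last exact: GH.
move=> HA; rewrite /fmap /nbhs /=.
have [//|nA] := in_ultra_setVsetC (f @^-1` A) UG.
have : H (~` A) by apply: GH.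
by move=> /(filterI HA); rewrite setICr => /filter_not_empty.
Qed.

Lemma ultra_compact_cvg (T : Type) (S : topologicalType) (G : set_system T)
    (f : T -> S) (K : set S) : UltraFilter G -> compact K ->
  (\forall t \near G, K (f t)) -> exists2 p, K p & f t @[t --> G] --> p.
Proof.
move=> UG; rewrite compact_ultra => cK GK.
by have [p [Kp fp]] := cK (f @ G) (ultra_fmap f UG) GK; exists p.
Qed.

Lemma exists_free_ultrafilter :
  exists U : set_system nat, UltraFilter U /\ \oo `<=` U.
Proof. exact: ultraFilterLemma. Qed.

End ultralimits.

Lemma vanishing_sequence (R : realType) : exists eps : nat -> R,
  [/\ forall k, 0 < eps k, forall k, eps k <= 1 &
      forall e : R, 0 < e -> \forall k \near \oo, eps k < e].
Proof.
exists (fun k => (k.+1%:R)^-1); split => [k|k|e e0].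
- by rewrite invr_gt0 ltr0Sn.
- by rewrite invf_le1// ler1n.
near=> k; rewrite invf_plt ?posrE//; apply: (@lt_trans _ _ k%:R); last by rewrite ltr_nat.
by near: k; exact: nbhs_infty_gtr.
Unshelve. all: by end_near. Qed.

(** * Compact sets of complex numbers and of row vectors *)

Section complex_compactness.
Context {R : realType}.

Lemma nr_continuous {V : normedModType R[i]} (z0 : V) :
  continuous (fun z : V => nr (z - z0)).
Proof.
move=> z; apply/cvgrPdist_lt => e e0; apply/nbhs_nrP; exists e => // w wz.
have := nr_triangle z w z0; have := nr_triangle w z z0.
rewrite [nr (z - w)]nrB => h1 h2.
by rewrite /= ltr_norml; apply/andP; split; lra.
Qed.

Lemma compact_square (M : R) :
  compact [set c : R[i] | `|complex.Re c| <= M /\ `|complex.Im c| <= M].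
Proof.
have -> : [set c : R[i] | `|complex.Re c| <= M /\ `|complex.Im c| <= M] =
    (fun p : R * R => Complex p.1 p.2) @` (`[- M, M] `*` `[- M, M]).
  apply/seteqP; split=> [[a b]/= [aM bM]|_ [[a b]/= + <-]].
    by exists (a, b) => //=; rewrite !in_itv/= -!ler_norml.
  by rewrite !in_itv/= -!ler_norml.
apply: continuous_compact; last by apply: compact_setX; exact: segment_compact.
apply: continuous_subspaceT => -[a b]; apply/cvg_nrP => e e0.
have e2 : 0 < e / 2 by rewrite divr_gt0.
near=> p; apply: le_lt_trans (nr_le_ReIm _) _ => /=.
have -> : e = e / 2 + e / 2 by field.
rewrite ltrD//; near: p.
  have : (fun p : R * R => p.1) @ (a, b) --> a by exact: cvg_fst.
  move/cvgrPdist_lt => /(_ _ e2); apply: filterS => p /=.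
  by rewrite distrC.
have : (fun p : R * R => p.2) @ (a, b) --> b by exact: cvg_snd.
move/cvgrPdist_lt => /(_ _ e2); apply: filterS => p /=.
by rewrite distrC.
Unshelve. all: by end_near. Qed.

Lemma nr_bounded_closed_compact {n : nat} (A : set 'rV[R[i]]_n) (M : R) :
  (forall v, A v -> nr v <= M) -> closed A -> compact A.
Proof.
move=> AM cA.
have C := rV_compact (fun _ : 'I_n => @compact_square M).
apply: (subclosed_compact cA C) => v /AM vM j.
split; first by rewrite (le_trans (Re_le_nr _))// (le_trans (nr_coord _ _)).
by rewrite (le_trans (Im_le_nr _))// (le_trans (nr_coord _ _)).
Qed.

Lemma nr_ball_compact {n : nat} (z0 : 'rV[R[i]]_n) (r : R) :
  compact [set z | nr (z - z0) <= r].
Proof.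
apply: (@nr_bounded_closed_compact _ _ (r + nr z0)) => [v /= vr|].
  by have := nrD (v - z0) z0; rewrite subrK; lra.
by apply: (@closed_comp _ _ _ [set x | x <= r]);
    [move=> z _; exact: nr_continuous|exact: closed_le].
Qed.

Lemma nr_sphere_compact {n : nat} (z0 : 'rV[R[i]]_n) (r : R) :
  compact [set z | nr (z - z0) = r].
Proof.
apply: (@nr_bounded_closed_compact _ _ (r + nr z0)) => [v /= vr|].
  by have := nrD (v - z0) z0; rewrite subrK; lra.
by apply: (@closed_comp _ _ _ [set x | x = r]);
    [move=> z _; exact: nr_continuous|exact: closed_eq].
Qed.

End complex_compactness.

Lemma piecewise_continuous {R : realType} {n : nat} (gamma : R -> 'rV[R[i]]_n)
    (a b : R) : piecewise gamma a b -> {within `[a, b], continuous gamma}.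
Proof.
elim=> [{}a|{}a x {}b ax C1 xb IH].
  by rewrite set_itv1; exact: continuous_subspace1.
have -> : `[a, b]%classic = `[a, x] `|` `[x, b] :> set R.
  have xb' := piecewise_le xb.
  apply/seteqP; split=> t; rewrite /= !in_itv/=.
    by have [tx|tx] := leP t x; move=> /andP[? ?]; [left|right]; apply/andP; split; lra.
  by move=> [|] /andP[? ?]; apply/andP; split; lra.
apply: withinU_continuous => //; [exact: itv_closed|exact: itv_closed|].
exact: C1_on_continuous.
Qed.

(** * Compactness of balls, geodesics *)

Section kobayashi_metric_space.
Context {R : realType} {n : nat}.
Variable D : set 'rV[R[i]]_n.
Hypotheses (oD : open D) (hD : complete_hyperbolic D).
Implicit Types (x y z w p q : 'rV[R[i]]_n).

Local Notation d := (kobayashi_dist D).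

Lemma kd_ge0 x y : D x -> D y -> 0 <= d x y.
Proof. by case: hD => -[+ _ _ _] _; apply. Qed.

Lemma kd_eq0 x y : D x -> D y -> d x y = 0 -> x = y.
Proof. by case: hD => -[_ h _ _] _ Dx Dy /h; apply. Qed.

Lemma kdxx x : D x -> d x x = 0.
Proof. by case: hD => -[_ h _ _] _ Dx; apply/h. Qed.

Lemma kd_sym x y : D x -> D y -> d x y = d y x.
Proof. by case: hD => -[_ _ + _] _; apply. Qed.

Lemma kd_triangle y x z : D x -> D y -> D z -> d x z <= d x y + d y z.
Proof. by case: hD => -[_ _ _ h] _ Dx Dy; exact: h. Qed.

(** By [kobayashi_dist_ball], Euclidean convergence to a point of [D] implies convergence for [d].
    The filter is arbitrary so that ultralimits are covered. *)
Lemma kd_small {T : Type} (G : set_system T) {FG : Filter G} (f : T -> 'rV[R[i]]_n) p :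
  D p -> f t @[t --> G] --> p ->
  forall e : R, 0 < e -> \forall t \near G, D (f t) /\ d p (f t) < e.
Proof.
move=> Dp /cvg_nrP fp e e0; have [r r0 rD] := open_ball oD Dp.
have r2 : 0 < r / 2 by rewrite divr_gt0.
have er : 0 < e * r / 2 by rewrite divr_gt0// mulr_gt0.
apply: filterS2 (fp _ r2) (fp _ er) => t tr te; split; first by apply: rD; lra.
apply: le_lt_trans (kobayashi_dist_ball r0 rD _ tr) _; first by rewrite subrr nr0.
rewrite mulrAC ltr_pdivrMr//; lra.
Qed.

Lemma kd_cvg {T : Type} (G : set_system T) {FG : Filter G}
    (f g : T -> 'rV[R[i]]_n) p q : D p -> D q ->
  f t @[t --> G] --> p -> g t @[t --> G] --> q ->
  d (f t) (g t) @[t --> G] --> d p q.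
Proof.
move=> Dp Dq fp gq; apply/cvgrPdist_lt => e e0.
have e2 : 0 < e / 2 by rewrite divr_gt0.
apply: filterS2 (kd_small Dp fp e2) (kd_small Dq gq e2) => t [Df dpf] [Dg dqg].
have h1 := kd_triangle Dp Df Dq; have h2 := kd_triangle Df Dg Dq.
have h3 := kd_triangle Df Dp Dg; have h4 := kd_triangle Dp Dq Dg.
have := kd_sym Dp Df; have := kd_sym Dq Dg => h5 h6.
by rewrite ltr_norml; apply/andP; split; lra.
Qed.

Lemma kd_continuous x y : D x -> D y -> d x z @[z --> y] --> d x y.
Proof.
by move=> Dx Dy; apply: (@kd_cvg _ (nbhs y) _ (cst x) id) => //; exact: cvg_cst.
Qed.

Lemma curve_ivt (gamma : R -> 'rV[R[i]]_n) (f : 'rV[R[i]]_n -> R) (c : R) :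
  curve_in D gamma -> (forall y, D y -> f z @[z --> y] --> f y) ->
  f (gamma 0) <= c <= f (gamma 1) ->
  exists2 t : R, 0 <= t <= 1 & f (gamma t) = c.
Proof.
move=> [gp gD] fc fg; have gc := piecewise_continuous gp.
have fgc : {within `[0, 1], continuous (f \o gamma)}.
  apply/subspace_continuousP => t t01; move/subspace_continuousP/(_ t t01) : gc => gc.
  exact: cvg_comp gc (fc _ (gD t t01)).
have [|t t01 ft] := IVT ler01 fgc (v := c).
  by rewrite /= ge_min le_max; move: fg => /andP[-> ->]; rewrite orbT.
by exists t => //; rewrite -in_itv.
Qed.

(** Almost intermediate points, taken on an almost shortest curve, stand in for geodesics until
    balls are known to be compact. *)
Lemma kd_between x y (s e : R) : D x -> D y -> 0 <= s <= d x y -> 0 < e ->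
  exists z, [/\ D z, d x z = s & d x z + d z y <= d x y + e].
Proof.
move=> Dx Dy /andP[s0 sxy] e0.
have [xy|/eqP xy] := eqVneq x y.
  exists x; split => //; rewrite kdxx//; last by rewrite add0r lerDl ltW.
  by move: sxy; rewrite xy kdxx// => ?; lra.
have [gamma [gD g0 g1 gL]] := kobayashi_dist_curve hD.1 Dx Dy xy e0.
have [t /andP[t0 t1] dt] := @curve_ivt gamma (d x) s gD (fun y Dy => kd_continuous Dx Dy)
  ltac:(by rewrite g0 g1 kdxx// s0).
have Dt : D (gamma t) by apply: gD.2; rewrite in_itv/= t0.
exists (gamma t); split => //.
have := kobayashi_dist_three oD hD.1 gD t0 (lexx t) t1 gL.
by rewrite g0 g1 (kdxx Dt) addr0.
Qed.

(* A curve from [z] leaving a Euclidean ball crosses its boundary, which is a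
   compact set on which the distance to [z] is positive. *)
Lemma kd_ball_small z (r : R) : D z -> 0 < r ->
  exists2 m : R, 0 < m & forall w, D w -> d z w < m -> nr (w - z) < r.
Proof.
move=> Dz r0; have [r1 r10 r1D] := open_ball oD Dz.
(* The sphere of radius [s] lies inside [D], where the distance to [z] is continuous and separates
   points. *)
pose s := Num.min r (r1 / 2).
have s0 : 0 < s by rewrite lt_min r0 divr_gt0.
have sr : s <= r by rewrite ge_min lexx.
have sr1 : s < r1.
  by have : s <= r1 / 2 by [rewrite ge_min lexx orbT]; lra.
apply: contrapT => nm.
have [eps [eps0 _ epsS]] := vanishing_sequence R.
have H (k : nat) : exists p, [/\ D p, nr (p - z) = s & d z p <= 2 * eps k].
  apply: contrapT => np; apply: nm; exists (eps k) => // w Dw dzw.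
  rewrite ltNge; apply/negP => rw.
  have zw : z <> w by move=> zw; move: rw; rewrite zw subrr nr0; lra.
  have [gamma [gD g0 g1 gL]] := kobayashi_dist_curve hD.1 Dz Dw zw (eps0 k).
  have [t /andP[t0 t1] dt] := @curve_ivt gamma (fun w => nr (w - z)) s gD
    (fun y _ => @nr_continuous _ _ z y)
    ltac:(by rewrite g0 g1 subrr nr0 (ltW s0) (le_trans sr)).
  have Dt : D (gamma t) by apply: gD.2; rewrite in_itv/= t0.
  apply: np; exists (gamma t); split => //.
  have := kobayashi_dist_three oD hD.1 gD t0 (lexx t) t1 gL.
  have := kd_ge0 Dt Dw.
  rewrite g0 g1 (kdxx Dt) addr0; lra.
have [p pP] := choice H.
have [U [UU Uoo]] := exists_free_ultrafilter.
have [q qs pq] : exists2 q, [set q | nr (q - z) = s] q & p k @[k --> U] --> q.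
  apply: (ultra_compact_cvg UU (@nr_sphere_compact _ _ z s)).
  by apply: nearW => k /=; have [] := pP k.
have Dq : D q by apply: r1D; rewrite qs.
have dq : d z (p k) @[k --> U] --> d z q.
  exact: (@kd_cvg _ U _ (cst z) p z q Dz Dq (cvg_cst _) pq).
have d0 : d z q <= 0.
  apply/ler_addgt0Pr => e e0; rewrite add0r.
  have e2 : 0 < e / 2 by rewrite divr_gt0.
  have h1 : \forall k \near U, `|d z q - d z (p k)| < e / 2.
    by move/cvgrPdist_lt : dq; apply.
  have h2 : \forall k \near U, eps k < e / 4 by apply/Uoo/epsS; rewrite divr_gt0.
  have [k [k1 k2]] := filter_ex (filterI h1 h2).
  have [_ _ k3] := pP k.
  by move: k1; rewrite ltr_norml => /andP[? ?]; lra.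
have : d z q = 0 by apply/eqP; rewrite eq_le d0 kd_ge0.
move=> /(kd_eq0 Dz Dq) zq; move: qs; rewrite /= -zq subrr nr0; lra.
Qed.

Definition kball x (r : R) := [set y | D y /\ d x y <= r].

Lemma kball_compact_sub (K : set 'rV[R[i]]_n) x (r : R) :
  compact K -> K `<=` D -> kball x r `<=` K -> D x -> compact (kball x r).
Proof.
move=> + KD xK Dx; rewrite !compact_ultra => cK U UU Ux.
have [p [Kp Up]] := cK U UU (filterS xK Ux).
exists p; split => //; split; first exact: KD.
apply/ler_addgt0Pr => e e0.
have dp : d x y @[y --> U] --> d x p.
  exact: (@kd_cvg _ U _ (cst x) id x p Dx (KD _ Kp) (cvg_cst _) Up).
move/cvgrPdist_lt/(_ e e0) : dp => dp.
have [y [[_ ry] ye]] := filter_ex (filterI Ux dp).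
by move: ye; rewrite ltr_norml => /andP[? ?]; lra.
Qed.

Lemma kball_locally_compact x : D x -> exists2 s : R, 0 < s & compact (kball x s).
Proof.
move=> Dx; have [r r0 rD] := open_ball oD Dx.
have r2 : 0 < r / 2 by rewrite divr_gt0.
have [m m0 mr] := kd_ball_small Dx r2.
exists (m / 2); first by rewrite divr_gt0.
apply: (@kball_compact_sub [set z | nr (z - x) <= r / 2]) => //.
- exact: nr_ball_compact.
- by move=> z /= zr; apply: rD; lra.
- by move=> y [Dy yx]; apply/ltW/mr => //; lra.
Qed.

(* The ultrafilter of a noncompact ball is carried to the compact ball of half
   the radius by a midpoint map. *)
Lemma kball_noncompact_step x (r : R) : D x -> 0 < r -> ~ compact (kball x r) ->
  exists y, [/\ D y, d x y <= r / 2 & ~ compact (kball y (3 / 4 * r))].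
Proof.
move=> Dx r0 nc; have [cx|ncx] := pselect (compact (kball x (r / 2))); last first.
  exists x; split => //; first by rewrite kdxx// ltW// divr_gt0.
  move=> c; apply: ncx; apply: (kball_compact_sub c) => //; first by move=> y [].
  by move=> y [Dy dy]; split => //; lra.
apply: contrapT => ny; apply: nc; rewrite compact_ultra => U UU Ux.
(* This slack [r / 8], and the distance below [r / 8] from [m y] to its limit [m0], complete [r / 2]
   to the radius [3 / 4 * r] around [m0]. *)
have mid y : exists m, kball x r y -> kball x (r / 2) m /\ d m y <= r / 2 + r / 8.
  have [[Dy dy]|nxy] := pselect (kball x r y); last by exists y.
  have [dxy|dxy] := leP (d x y) (r / 2).
    by exists y => _; split => //; rewrite kdxx//; lra.
  have [m [Dm dm1 dm2]] : exists m, [/\ D m, d x m = r / 2 &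
      d x m + d m y <= d x y + r / 8].
    by apply: kd_between => //; [apply/andP; split; lra|rewrite divr_gt0].
  by exists m => _; split; [split => //; lra|lra].
have [m mP] := choice mid.
have Um : \forall y \near U, kball x (r / 2) (m y).
  by apply: filterS Ux => y /mP[].
have [m0 [Dm0 xm0] mm0] := ultra_compact_cvg UU cx Um.
have [cm0|] := pselect (compact (kball m0 (3 / 4 * r))); last first.
  by move=> ncm; case: ny; exists m0.
have r8 : 0 < r / 8 by rewrite divr_gt0.
have Um0 : U (kball m0 (3 / 4 * r)).
  apply: filterS2 (kd_small Dm0 mm0 r8) Ux => y [Dm dm] xy.
  have [Dy _] := xy; have [_ my] := mP _ xy.
  by split => //; have := kd_triangle Dm0 Dm Dy; lra.
move: cm0; rewrite compact_ultra => /(_ U UU Um0) [p [[Dp _] Up]].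
exists p; split => //; split => //.
apply/ler_addgt0Pr => e e0.
have dp : d x y @[y --> U] --> d x p.
  exact: (@kd_cvg _ U _ (cst x) id x p Dx Dp (cvg_cst _) Up).
move/cvgrPdist_lt/(_ e e0) : dp => dp.
have [y [[_ ry] ye]] := filter_ex (filterI Ux dp).
by move: ye; rewrite ltr_norml => /andP[? ?]; lra.
Qed.

Lemma geometric_tail (u : nat -> R) : (forall k, 0 <= u k) ->
  (forall k, u k.+1 = 3 / 4 * u k) -> forall e : R, 0 < e -> exists N, u N < e.
Proof.
move=> u0 uS e e0.
have p0 k : 0 <= (3 / 4 : R) ^+ k by apply: exprn_ge0; lra.
have uE k : u k = u 0%N * (3 / 4) ^+ k.
  by elim: k => [|k IH]; rewrite ?expr0 ?mulr1// uS IH exprS; ring.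
have : (3 / 4 : R) ^+ k @[k --> \oo] --> 0.
  by apply: cvg_expr; rewrite ger0_norm; lra.
move=> /cvgrPdist_lt/(_ (e / (u 0%N + 1))) []; first by rewrite divr_gt0// ltr_wpDl.
move=> N _ /(_ N (leqnn N)); rewrite sub0r normrN ger0_norm//.
rewrite ltr_pdivlMr ?ltr_wpDl// => h.
exists N; rewrite uE; have := u0 0%N.
have := p0 N.
move: h; set x := _ ^+ N; set y := u 0%N; nra.
Qed.

(** From a noncompact ball, [kball_noncompact_step] builds noncompact balls with radii shrinking by
    [3 / 4] and centres forming a Cauchy sequence. By completeness the centres converge, and some
    ball of the sequence lies in a compact ball around the limit. *)
Theorem kball_compact x (r : R) : D x -> compact (kball x r).
Proof.
move=> Dx; apply: contrapT => nc.
wlog r0 : r nc / 0 < r.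
  move=> H; apply: (H (`|r| + 1)); last by rewrite ltr_wpDl.
  move=> c; apply: nc; apply: (kball_compact_sub c) => //; first by move=> y [].
  move=> y [Dy dy]; split => //; have := ler_norm r; lra.
pose bad (p : 'rV[R[i]]_n * R) := [/\ D p.1, 0 < p.2 & ~ compact (kball p.1 p.2)].
have step (p : 'rV[R[i]]_n * R) : exists q : 'rV[R[i]]_n * R, bad p ->
    [/\ bad q, d p.1 q.1 <= p.2 / 2 & q.2 = 3 / 4 * p.2].
  have [[Dp p0 np]|] := pselect (bad p); last by exists p.
  have [y [Dy dy ny]] := kball_noncompact_step Dp p0 np.
  exists (y, 3 / 4 * p.2) => _; split => //; split => //=.
  by rewrite mulr_gt0.
have [f fP] := choice step.
pose s k := iter k f (x, r).
have sbad k : bad (s k).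
  by elim: k => [|k IH] //; have [] := fP _ IH.
pose X k := (s k).1; pose u k := (s k).2.
have uS k : u k.+1 = 3 / 4 * u k by have [] := fP _ (sbad k).
have DX k : D (X k) by have [] := sbad k.
have u0 k : 0 < u k by have [] := sbad k.
have dX k : d (X k) (X k.+1) <= u k / 2 by have [] := fP _ (sbad k).
(* The sum telescopes because [u k / 2 = 2 * (u k - u k.+1)]. *)
have tail k m : d (X k) (X (k + m)%N) <= 2 * (u k - u (k + m)%N).
  elim: m => [|m IH]; first by rewrite addn0 kdxx// subrr mulr0.
  rewrite addnS; have := kd_triangle (DX k) (DX (k + m)%N) (DX (k + m).+1).
  by have := dX (k + m)%N; rewrite uS; lra.
have small := geometric_tail (fun k => ltW (u0 k)) uS.
have cauchy (e : R) : 0 < e -> exists N, forall l m, (N <= l)%N -> (N <= m)%N ->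
    d (X l) (X m) < e.
  move=> e0; have [N Ne] := small (e / 4) (divr_gt0 e0 (ltr0Sn _ _)).
  exists N => l m Nl Nm.
  have := tail N (l - N)%N; have := tail N (m - N)%N; rewrite !subnKC//.
  have := u0 l; have := u0 m; have := kd_triangle (DX l) (DX N) (DX m).
  rewrite (kd_sym (DX l) (DX N)); lra.
have [y Dy Xy] := hD.2 X DX cauchy.
have [t t0 ct] := kball_locally_compact Dy.
have t2 : 0 < t / 4 by rewrite divr_gt0.
have [N NuE] := small _ t2.
move/cvgrPdist_lt/(_ _ t2) : Xy => [M _ MP].
have [k [Nk Mk]] : exists k, (N <= k)%N /\ (M <= k)%N.
  by exists (maxn N M); rewrite leq_maxl leq_maxr.
have uk : u k < t / 4.
  apply: le_lt_trans NuE; have := tail N (k - N)%N; rewrite subnKC//.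
  have := kd_ge0 (DX N) (DX k); lra.
have := MP k Mk; rewrite /= sub0r normrN ger0_norm ?kd_ge0// => dXy.
have [_ _ nck] := sbad k; apply: nck; apply: (kball_compact_sub ct); last exact: DX.
  by move=> z [].
move=> z [Dz dz]; split => //.
have := kd_triangle Dy (DX k) Dz; rewrite (kd_sym Dy (DX k)) -/(X k).
by have : d (X k) z <= u k by []; lra.
Qed.

(** Almost geodesics with errors tending to 0 stay in a compact ball, and their ultralimits, taken
    for every parameter along the same indices, have exact distances. *)
Theorem geodesic_exists x y : D x -> D y -> exists gamma : R -> 'rV[R[i]]_n,
  [/\ geodesic D `[0, d x y] gamma, gamma 0 = x & gamma (d x y) = y].
Proof.
move=> Dx Dy; set L := d x y.
have L0 : 0 <= L by apply: kd_ge0.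
(* Points at distance [s] from [x] on a curve of length at most [L + e] form an
   [e]-almost geodesic. *)
have near_geodesic (e : R) : 0 < e -> exists f : R -> 'rV[R[i]]_n,
    (forall s, 0 <= s <= L -> D (f s)) /\ d (f L) y <= e /\
    d x (f 0) <= e /\
    forall s t, 0 <= s <= L -> 0 <= t <= L ->
      `|s - t| <= d (f s) (f t) <= `|s - t| + e.
  move=> e0; have [xy|/eqP xy] := eqVneq x y.
    have LE : L = 0 by rewrite /L xy kdxx.
    exists (fun=> x); split => //; split; first by rewrite xy kdxx// ltW.
    split; first by rewrite kdxx// ltW.
    move=> s t; rewrite LE => ? ?; rewrite kdxx//.
    have -> : s = 0 by lra. have -> : t = 0 by lra.
    by rewrite subrr normr0 lexx add0r ltW.
  have [gamma [gD g0 g1 gL]] := kobayashi_dist_curve hD.1 Dx Dy xy e0.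
  have par (s : R) : exists t : R, 0 <= s <= L -> 0 <= t <= 1 /\ d x (gamma t) = s.
    have [sL|] := pselect (0 <= s <= L); last by exists 0.
    have [t t01 dt] := @curve_ivt gamma (d x) s gD (fun y Dy => kd_continuous Dx Dy)
      ltac:(by rewrite g0 g1 kdxx).
    by exists t.
  have [tau tauP] := choice par.
  have Dg (t : R) : 0 <= t <= 1 -> D (gamma t) by move=> t01; apply: gD.2; rewrite in_itv.
  have [L01 dL] := tauP L ltac:(by rewrite L0 lexx).
  have [z01 dz] := tauP 0 ltac:(by rewrite lexx).
  exists (gamma \o tau); split; first by move=> s /tauP[/Dg].
  have gy (t : R) : 0 <= t <= 1 -> d x (gamma t) + d (gamma t) y <= L + e.
    move=> t01; have Dt := Dg t t01; move/andP: t01 => [t0 t1].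
    have := kobayashi_dist_three oD hD.1 gD t0 (lexx t) t1 gL.
    by rewrite g0 g1 (kdxx Dt) addr0.
  split; first by have := gy _ L01; rewrite dL; lra.
  split; first by rewrite /= dz ltW.
  (* [tau] may fail to be monotone, as the curve can cross a sphere around [x] several times; both
     orders of [tau s] and [tau t] lead to the bound. *)
  have half s t : 0 <= s <= L -> 0 <= t <= L -> s <= t ->
      d (gamma (tau s)) (gamma (tau t)) <= t - s + e.
    move=> sL tL st; have [s01 ds] := tauP s sL; have [t01 dt] := tauP t tL.
    have Ds := Dg _ s01; have Dt := Dg _ t01.
    have hs := kd_triangle Dx Ds Dy; have ht := kd_triangle Dx Dt Dy.
    rewrite -/L ds in hs; rewrite -/L dt in ht.
    move: (s01) (t01) => /andP[s0 s1] /andP[t0 t1].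
    have [lt|lt] := leP (tau s) (tau t).
      have := kobayashi_dist_three oD hD.1 gD s0 lt t1 gL.
      by rewrite g0 g1 ds -/L; lra.
    have := kobayashi_dist_three oD hD.1 gD t0 (ltW lt) s1 gL.
    by rewrite g0 g1 dt (kd_sym Dt Ds) -/L; lra.
  move=> s t sL tL /=; have [s01 ds] := tauP s sL; have [t01 dt] := tauP t tL.
  have Ds := Dg _ s01; have Dt := Dg _ t01.
  have h1 := kd_triangle Dx Ds Dt; have h2 := kd_triangle Dx Dt Ds.
  have h3 := kd_sym Ds Dt; rewrite ds dt -?h3 in h1 h2.
  have [st|ts] := leP s t.
    have := half s t sL tL st; rewrite ler0_norm ?subr_le0// => ?.
    by apply/andP; split; lra.
  have := half t s tL sL (ltW ts); rewrite -h3 gtr0_norm ?subr_gt0// => ?.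
  by apply/andP; split; lra.
have [eps [e0 e1 epsS]] := vanishing_sequence R.
have [f fP] := choice (fun k => near_geodesic _ (e0 k)).
have [U [UU Uoo]] := exists_free_ultrafilter.
have lim (s : R) : exists p, 0 <= s <= L -> D p /\ f k s @[k --> U] --> p.
  have [sL|] := pselect (0 <= s <= L); last by exists x.
  (* The 2 absorbs two errors [eps k <= 1]: from [x] to [f k 0], and from [f k 0] to [f k s]. *)
  have Uf : \forall k \near U, kball x (L + 2) (f k s).
    apply: nearW => k; have [Df [_ [fx ff]]] := fP k; split; first exact: Df.
    have zL : 0 <= (0 : R) <= L by rewrite lexx.
    have /andP[_] := ff 0 s zL sL; have := kd_triangle Dx (Df _ zL) (Df _ sL).
    have := e1 k; have [s0 s1] := andP sL; rewrite sub0r normrN ger0_norm//; lra.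
  by have [p [Dp _] fp] := ultra_compact_cvg UU (@kball_compact x (L + 2) Dx) Uf; exists p.
have [g gP] := choice lim.
(* An ultralimit of distances within [eps k] of [c] is [c]. *)
have squeeze (u : nat -> R) (c l : R) : u k @[k --> U] --> l ->
    (forall k, `|u k - c| <= eps k) -> l = c.
  move=> ul uc; apply/eqP; rewrite -subr_eq0 -normr_eq0 eq_le normr_ge0 andbT.
  apply/ler_addgt0Pr => e ee; rewrite add0r.
  have ee2 : 0 < e / 2 by rewrite divr_gt0.
  move/cvgrPdist_lt/(_ _ ee2) : ul => ul.
  have [k [k1 k2]] := filter_ex (filterI ul (Uoo _ (epsS _ ee2))).
  have := uc k; have := ler_normD (l - u k) (u k - c); rewrite subrKA.
  lra.
exists g; split.
- split=> [t|s t]; rewrite /= !in_itv/=; first by move=> /gP[].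
  move=> sL tL; have [Ds gs] := gP s sL; have [Dt gt] := gP t tL.
  apply: (squeeze _ _ _ (@kd_cvg _ U _ _ _ _ _ Ds Dt gs gt)) => k.
  have [_ [_ [_ ff]]] := fP k; have /andP[? ?] := ff s t sL tL.
  rewrite ger0_norm ?subr_ge0//; lra.
- have zL : 0 <= (0 : R) <= L by rewrite lexx.
  have [D0 g0] := gP 0 zL; apply/esym/(kd_eq0 Dx D0).
  apply: (squeeze _ _ _ (@kd_cvg _ U _ (cst x) _ _ _ Dx D0 (cvg_cst _) g0)) => k.
  have [Df [_ [fx _]]] := fP k.
  by rewrite subr0 ger0_norm// kd_ge0//; exact: Df.
- have zL : 0 <= L <= L by rewrite L0 lexx.
  have [D0 g0] := gP L zL; apply: (kd_eq0 D0 Dy).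
  apply: (squeeze _ _ _ (@kd_cvg _ U _ _ (cst y) _ _ D0 Dy g0 (cvg_cst _))) => k.
  have [Df [fx _]] := fP k.
  by rewrite subr0 ger0_norm// kd_ge0//; exact: Df.
Qed.

Lemma kd_bounded (K : set 'rV[R[i]]_n) x : compact K -> K `<=` D -> D x ->
  exists B : R, forall y, K y -> d x y <= B.
Proof.
move=> cK KD Dx; apply: contrapT => nB.
have H (k : nat) : exists y, K y /\ k%:R < d x y.
  apply: contrapT => ny; apply: nB; exists k%:R => y Ky.
  by rewrite leNgt; apply/negP => lt; apply: ny; exists y.
have [y yP] := choice H.
have [U [UU Uoo]] := exists_free_ultrafilter.
have [p Kp yp] := ultra_compact_cvg UU cK (nearW _ (fun k => (yP k).1)).
have Dp := KD _ Kp.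
have dp : d x (y k) @[k --> U] --> d x p.
  exact: (@kd_cvg _ U _ (cst x) y x p Dx Dp (cvg_cst _) yp).
move/cvgrPdist_lt/(_ _ ltr01) : dp => h1.
have h2 : \forall k \near U, d x p + 1 <= k%:R.
  by apply: Uoo; exact: nbhs_infty_ger.
have [k [k1 k2]] := filter_ex (filterI h1 h2).
have := (yP k).2; move: k1; rewrite ltr_norml => /andP[? ?]; lra.
Qed.

(* If [gamma] does not converge to [p], it accumulates at some other boundary
   point [q]; visibility of [q] and [p] makes every [sigma k] return to a fixed
   compact set after a time tending to infinity. *)
Lemma geodesic_ray_lands (U : set_system nat) (sigma : nat -> R -> 'rV[R[i]]_n)
    (T : nat -> R) (gamma : R -> 'rV[R[i]]_n) p :
  UltraFilter U -> \oo `<=` U -> visibility_property D -> compact (closure D) ->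
  boundary D p ->
  (forall M : R, \forall k \near U, M < T k) ->
  (forall k, geodesic D `[0, T k] (sigma k)) ->
  sigma k (T k) @[k --> U] --> p ->
  (forall t : R, 0 <= t -> D (gamma t) /\ sigma k t @[k --> U] --> gamma t) ->
  gamma t @[t --> +oo] --> p.
Proof.
move=> UU Uoo visD cD bp Too sg sp gP.
have gd (s t : R) : 0 <= s -> 0 <= t -> d (gamma s) (gamma t) = `|s - t|.
  move=> s0 t0; have [Ds gs] := gP s s0; have [Dt gt] := gP t t0.
  have h1 : d (sigma k s) (sigma k t) @[k --> U] --> d (gamma s) (gamma t).
    exact: (@kd_cvg _ U _ _ _ _ _ Ds Dt gs gt).
  have h2 : d (sigma k s) (sigma k t) @[k --> U] --> `|s - t|.
    apply: cvg_near_cst; apply: filterS2 (Too s) (Too t) => k sk tk.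
    by apply: (sg k).2; rewrite /= in_itv/= ?s0 ?t0/= ltW.
  by apply: (cvg_unique _ h1 h2); exact: norm_hausdorff.
apply: contrapT => ncvg.
have [e [e0 H]] : exists e : R, 0 < e /\
    forall M : R, exists t, M < t /\ e <= nr (gamma t - p).
  apply: contrapT => ne; apply: ncvg; apply/cvg_nrP => e e0.
  apply: contrapT => nt; apply: ne; exists e; split => // M.
  apply: contrapT => nM; apply: nt; exists M; split; first exact: num_real.
  by move=> t Mt; rewrite ltNge; apply/negP => et; apply: nM; exists t.
have [t tP] := choice (fun k : nat => H k%:R).
have t0 k : 0 <= t k by have [kt _] := tP k; apply: le_trans (ltW kt).
have [q cq gq] : exists2 q : 'rV[R[i]]_n, closure D q & gamma (t k) @[k --> U] --> q.
  apply: (ultra_compact_cvg UU cD); apply: nearW => k.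
  by have [Dg _] := gP _ (t0 k); exact: (subset_closure Dg).
have D0 := (gP 0 (lexx _)).1.
(* [gamma (t k)] is at distance [t k] from [gamma 0], and [t k] exceeds [k], so it cannot accumulate
   inside [D]. *)
have nDq : ~ D q.
  move=> Dq.
  have dq : d (gamma 0) (gamma (t k)) @[k --> U] --> d (gamma 0) q.
    exact: (@kd_cvg _ U _ (cst (gamma 0)) _ _ _ D0 Dq (cvg_cst _) gq).
  move/cvgrPdist_lt/(_ _ ltr01) : dq => h1.
  have h2 : \forall k \near U, d (gamma 0) q + 1 <= k%:R.
    by apply: Uoo; exact: nbhs_infty_ger.
  have [k [k1 k2]] := filter_ex (filterI h1 h2).
  have [kt _] := tP k; move: k1.
  rewrite (gd _ _ (lexx 0) (t0 k)) sub0r normrN (ger0_norm (t0 k)) ltr_norml.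
  by move=> /andP[? ?]; lra.
have bq : boundary D q := conj cq (fun h => nDq (interior_subset h)).
have qp : q <> p.
  move=> qp; move/cvg_nrP/(_ _ e0) : gq => h.
  have [k] := filter_ex h; rewrite qp; have [_] := tP k; lra.
have [A [B [K [[nA nB _] [cK KD vK]]]]] := visD q p bq bp qp.
have [C CP] := kd_bounded cK KD D0.
(* The interior is used because [sigma k s], which only converges to [gamma s], has to lie in
   [A]. *)
have : \forall k \near U, (interior A) (gamma (t k)) /\ C + 1 < k%:R.
  have hA O : nbhs q O -> \forall k \near U, O (gamma (t k)) by move=> nO; exact: gq.
  apply: (filterI (hA _ (nbhs_interior nA))).
  by apply: Uoo; exact: nbhs_infty_gtr.
move=> /filter_ex[m [Am Cm]].
have [tm _] := tP m; set s := t m in tm Am.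
have s0 : 0 <= s by exact: t0.
have [Ds gs] := gP s s0.
have h1 : \forall k \near U, A (sigma k s) by apply: gs; exact: Am.
have h2 : \forall k \near U, B (sigma k (T k)) by exact: sp.
have [_ g0] := gP 0 (lexx _).
have h3 : \forall k \near U, D (sigma k 0) /\ d (gamma 0) (sigma k 0) < 1.
  exact: (@kd_small _ U _ _ _ D0 g0 _ ltr01).
have [k [[k1 k2] [[Dk0 k3] k4]]] :=
  filter_ex (filterI (filterI h1 h2) (filterI h3 (Too s))).
have shift (u : R) : 0 <= u <= T k - s -> 0 <= s + u <= T k.
  by move=> /andP[? ?]; apply/andP; split; lra.
(* The piece of [sigma k] on [[s, T k]] goes from [A] to [B], hence meets [K] at a time
   [s + u > C + 1]. But points of [K] are at distance below [C + 1] from [sigma k 0]. *)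
have [||||u] := vK (T k - s) (fun u => sigma k (s + u)).
- by rewrite subr_ge0 ltW.
- split=> [u|u v]; rewrite /= !in_itv/=.
    by move=> /shift uT; apply: (sg k).1; rewrite /= in_itv.
  move=> /shift uT /shift vT; rewrite (sg k).2; last 2 first.
  + by rewrite /= in_itv; exact: uT.
  + by rewrite /= in_itv; exact: vT.
  by rewrite opprD addrACA subrr add0r.
- by rewrite addr0.
- by rewrite addrC subrK.
rewrite in_itv/= => us Ku.
have := CP _ Ku.
have Du : D (sigma k (s + u)) by exact: KD.
have k00 : 0 <= (0 : R) <= T k by rewrite lexx/=; lra.
have : d (sigma k 0) (sigma k (s + u)) = s + u.
  rewrite (sg k).2; last 2 first.
  - by rewrite /= in_itv; exact: k00.
  - by rewrite /= in_itv; exact: shift.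
  have su0 : 0 <= s + u by move/andP: us => [? ?]; lra.
  by rewrite sub0r normrN (ger0_norm su0).
have := kd_triangle Dk0 D0 Du; rewrite (kd_sym Dk0 D0).
by move/andP: us => [? ?]; lra.
Qed.

End kobayashi_metric_space.
(** * Boundary values *)

Lemma cluster_of_cvg (T : topologicalType) (G : set_system T) {PG : ProperFilter G} p :
  hausdorff_space T -> G --> p -> cluster G = [set p].
Proof.
move=> hT Gp; apply/seteqP; split=> [q /(cvg_cluster Gp) /hT //|_ -> A B GA nB].
exact: (filter_ex (filterI GA (Gp _ nB))).
Qed.

Section boundary_extension.
Context {R : realType} {n : nat}.
Variables (D1 D2 : set 'rV[R[i]]_n) (F G : 'rV[R[i]]_n -> 'rV[R[i]]_n).
Hypotheses (oD1 : open D1) (oD2 : open D2).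
Hypotheses (cD1 : compact (closure D1)) (cD2 : compact (closure D2)).
Hypotheses (hD1 : complete_hyperbolic D1) (hD2 : complete_hyperbolic D2).
Hypotheses (visD1 : visibility_property D1) (visD2 : visibility_property D2).
Hypothesis loopD1 : no_geodesic_loops D1.
Hypotheses (dF : holomorphic_on D1 F) (dG : holomorphic_on D2 G).
Hypotheses (FD : forall z, D1 z -> D2 (F z)) (GD : forall w, D2 w -> D1 (G w)).
Hypotheses (FK : forall z, D1 z -> G (F z) = z) (GK : forall w, D2 w -> F (G w) = w).

Local Notation d1 := (kobayashi_dist D1).
Local Notation d2 := (kobayashi_dist D2).

Lemma inverse_isometry a b : D2 a -> D2 b -> d1 (G a) (G b) = d2 a b.
Proof.
move=> Da Db; apply/eqP; rewrite eq_le; apply/andP; split.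
  exact: (kobayashi_dist_holomorphic oD2 hD2.1 hD1.1 dG GD Da Db).
have := kobayashi_dist_holomorphic oD1 hD1.1 hD2.1 dF FD (GD Da) (GD Db).
by rewrite !GK.
Qed.

Section ultralimit.
Variable U : set_system nat.
Hypotheses (UU : UltraFilter U) (Uoo : \oo `<=` U).

(** If [q] were in [D2], continuity of [G] at [q] would make [z k] converge to [G q], a point of
    [D1]. *)
Lemma image_limit_boundary (z : nat -> 'rV[R[i]]_n) (p q : 'rV[R[i]]_n) : boundary D1 p ->
  (forall k, D1 (z k)) -> z k @[k --> U] --> p -> F (z k) @[k --> U] --> q ->
  boundary D2 q.
Proof.
move=> [_ nDp] Dz zp Fq; split.
  move=> B nB; have : \forall k \near U, B (F (z k)) by exact: Fq.
  move=> /filter_ex[k Bk]; by exists (F (z k)); split => //; exact: FD.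
move=> /interior_subset Dq; apply: nDp; rewrite (interior_id D1).1//.
have Gq' : G x @[x --> q] --> G q := differentiable_continuous (dG Dq).
have : G (F (z k)) @[k --> U] --> G q by exact: (cvg_comp _ _ Fq Gq').
under eq_fun do rewrite FK//.
by move=> Gq; rewrite (cvg_unique _ zp Gq); [exact: GD|exact: norm_hausdorff].
Qed.

Lemma boundary_limit_unique (z w : nat -> 'rV[R[i]]_n) (p q q' : 'rV[R[i]]_n) : boundary D1 p ->
  (forall k, D1 (z k)) -> (forall k, D1 (w k)) ->
  z k @[k --> U] --> p -> w k @[k --> U] --> p ->
  F (z k) @[k --> U] --> q -> F (w k) @[k --> U] --> q' -> q = q'.
Proof.
move=> bp Dz Dw zp wp Fz Fw; apply: contrapT => qq'.
have bq := image_limit_boundary bp Dz zp Fz.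
have bq' := image_limit_boundary bp Dw wp Fw.
have [A [B [K [[nA nB _] [cK KD vK]]]]] := visD2 bq bq' qq'.
have nDp : ~ D1 p by case: bp => _; rewrite (interior_id D1).1.
have DF k : D2 (F (z k)) := FD (Dz k).
have DF' k : D2 (F (w k)) := FD (Dw k).
pose L k := d2 (F (z k)) (F (w k)).
have [c cP] := choice (fun k => geodesic_exists oD2 hD2 (DF k) (DF' k)).
have [tau tauP] : exists tau : nat -> R, \forall k \near U,
    0 <= tau k <= L k /\ K (c k (tau k)).
  have ex k : exists t : R, A (F (z k)) /\ B (F (w k)) -> 0 <= t <= L k /\ K (c k t).
    have [[Ak Bk]|] := pselect (A (F (z k)) /\ B (F (w k))); last by exists 0.
    have [gk g0 g1] := cP k.
    have [|||t] := vK (L k) (c k) _ gk; rewrite ?g0 ?g1//.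
      exact: (kd_ge0 hD2).
    by rewrite in_itv/= => tL Kt; exists t.
  have [tau tauP] := choice ex; exists tau.
  have hA : \forall k \near U, A (F (z k)) by exact: Fz.
  have hB : \forall k \near U, B (F (w k)) by exact: Fw.
  by apply: filterS2 hA hB => k Ak Bk; exact: tauP.
(* Time is shifted so that, for almost all [k], [sigma k 0] is the image of a point of [K]. It then
   converges in [D1] and anchors the limit line, while [z k] and [w k] sit at the times [- tau k]
   and [L k - tau k]. *)
pose sigma k t := G (c k (tau k + t)).
have sigD k t : 0 <= tau k + t <= L k -> D1 (sigma k t).
  by move=> tk; apply: GD; have [[gD _] _ _] := cP k; apply: gD; rewrite /= in_itv.
have sigd k s t : 0 <= tau k + s <= L k -> 0 <= tau k + t <= L k ->
    d1 (sigma k s) (sigma k t) = `|s - t|.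
  move=> sk tk; have [[gD gd] _ _] := cP k.
  rewrite inverse_isometry ?gd/= ?in_itv//; try by apply: gD; rewrite /= in_itv.
  by rewrite opprD addrACA subrr add0r.
have sigz k : sigma k (- tau k) = z k.
  by rewrite /sigma subrr; have [_ -> _] := cP k; rewrite FK.
have sigw k : sigma k (L k - tau k) = w k.
  by rewrite /sigma addrC subrK; have [_ _ ->] := cP k; rewrite FK.
have Kc : \forall k \near U, K (c k (tau k)) by apply: filterS tauP => k [].
have [b Kb cb] := ultra_compact_cvg UU cK Kc.
have Gb' : G x @[x --> b] --> G b := differentiable_continuous (dG (KD _ Kb)).
have Gb : sigma k 0 @[k --> U] --> G b.
  rewrite /sigma; under eq_fun do rewrite addr0.
  exact: (cvg_comp _ _ cb Gb').
have DGb : D1 (G b) by exact/GD/KD.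
have near_b : \forall k \near U, D1 (sigma k 0) /\ d1 (G b) (sigma k 0) < 1.
  exact: (@kd_small _ _ _ oD1 _ U _ _ _ DGb Gb _ ltr01).
(* The ends of [sigma k] leave every compact subset of [D1]. *)
have escape (v : nat -> 'rV[R[i]]_n) (M : R) : (forall k, D1 (v k)) ->
    v k @[k --> U] --> p -> \forall k \near U, M < d1 (sigma k 0) (v k).
  move=> Dv vp; have [h|h] := in_ultra_setVsetC
    [set k | M < d1 (sigma k 0) (v k)] UU; first exact: h.
  exfalso; apply: nDp.
  have cB := @kball_compact _ _ _ oD1 hD1 (G b) (M + 1) DGb.
  have Uv : \forall k \near U, kball D1 (G b) (M + 1) (v k).
    apply: filterS2 h near_b => k /= kM [Ds ds].
    split; first exact: Dv.
    have := kd_triangle hD1 DGb Ds (Dv k); move/negP: kM; rewrite -leNgt; lra.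
  have [x [Dx _] vx] := ultra_compact_cvg UU cB Uv.
  by rewrite (cvg_unique _ vp vx)//; exact: norm_hausdorff.
have tau_oo (M : R) : \forall k \near U, M < tau k.
  apply: filterS2 tauP (escape z M Dz zp) => k [kL _].
  rewrite -[z k]sigz sigd ?addr0 ?subrr ?lexx/=; [|exact: kL|].
    by rewrite opprK add0r ger0_norm//; move/andP: kL => [].
  by move/andP: kL => [? ?]; lra.
have L_oo (M : R) : \forall k \near U, M < L k - tau k.
  apply: filterS2 tauP (escape w M Dw wp) => k [kL _].
  rewrite -[w k]sigw sigd ?addr0; [|exact: kL|].
    by rewrite sub0r normrN ger0_norm// subr_ge0; move/andP: kL => [].
  by rewrite addrC subrK lexx andbT; move/andP: kL => [? ?]; lra.
have lim t : exists x, D1 x /\ sigma k t @[k --> U] --> x.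
  have cB := @kball_compact _ _ _ oD1 hD1 (G b) (`|t| + 1) DGb.
  have Us : \forall k \near U, kball D1 (G b) (`|t| + 1) (sigma k t).
    apply: filterS3 near_b (tau_oo `|t|) (L_oo `|t|) => k [Ds ds] t1 t2.
    have [tn tp] : - `|t| <= t /\ t <= `|t| by apply/andP; rewrite -ler_norml.
    have k0 : 0 <= tau k + 0 <= L k by apply/andP; split; lra.
    have kt : 0 <= tau k + t <= L k by apply/andP; split; lra.
    have Dt := sigD k t kt.
    split => //; have := kd_triangle hD1 DGb Ds Dt.
    by rewrite (sigd k _ _ k0 kt) sub0r normrN; lra.
  by have [x [Dx _] sx] := ultra_compact_cvg UU cB Us; exists x.
have [gamma gP] := choice lim.
have line : geodesic_line D1 gamma.
  split=> [t _|s t _ _]; first by have [] := gP t.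
  have [Ds gs] := gP s; have [Dt gt] := gP t.
  have h1 : d1 (sigma k s) (sigma k t) @[k --> U] --> d1 (gamma s) (gamma t).
    exact: (@kd_cvg _ _ _ oD1 hD1 _ U _ _ _ _ _ Ds Dt gs gt).
  have h2 : d1 (sigma k s) (sigma k t) @[k --> U] --> `|s - t|.
    apply: cvg_near_cst.
    apply: filterS2 (tau_oo (`|s| + `|t|)) (L_oo (`|s| + `|t|)) => k h3 h4.
    have [? ?] : - `|s| <= s /\ s <= `|s| by apply/andP; rewrite -ler_norml.
    have [? ?] : - `|t| <= t /\ t <= `|t| by apply/andP; rewrite -ler_norml.
    have := normr_ge0 s; have := normr_ge0 t => ? ?.
    by apply: sigd; apply/andP; split; lra.
  by apply: (cvg_unique _ h1 h2); exact: norm_hausdorff.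
(* [sigma k] restricted to positive times, cut off where it is not known to be
   a geodesic. *)
have ray (eps : R) (T : nat -> R) (v : nat -> 'rV[R[i]]_n) :
    (eps = 1 \/ eps = -1) -> (forall M, \forall k \near U, M < T k) ->
    (\forall k \near U, forall t : R, 0 <= t <= T k -> 0 <= tau k + eps * t <= L k) ->
    (\forall k \near U, sigma k (eps * T k) = v k) ->
    v k @[k --> U] --> p -> gamma (eps * t) @[t --> +oo] --> p.
  move=> eps1 Too Tin Tv vp.
  pose good k := forall t : R, 0 <= t <= T k -> 0 <= tau k + eps * t <= L k.
  (* [geodesic_ray_lands] asks for a geodesic at every index; with the value [-1] the segment is
     empty and the condition vacuous. *)
  pose T' k := if pselect (good k) then T k else -1.
  have T'E : \forall k \near U, T' k = T k.
    by apply: filterS Tin => k gk; rewrite /T'; case: pselect.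
  apply: (geodesic_ray_lands oD1 hD1 (sigma := fun k t => sigma k (eps * t))
    (T := T') UU Uoo visD1 cD1 bp).
  - by move=> M; apply: filterS2 T'E (Too M) => k ->.
  - move=> k; have [[gk ->]|->] : (good k /\ T' k = T k) \/ T' k = -1;
      [by rewrite /T'; case: pselect => gk; [left|right]| |]; last first.
      by split=> [t|s t]; rewrite /= in_itv/= => /andP[t0 /(le_trans t0)];
        rewrite ler0N1.
    split=> [t|s t]; rewrite /= !in_itv/=; first by move=> /gk; exact: sigD.
    move=> /gk sk /gk tk; rewrite sigd// -mulrBr normrM.
    by case: eps1 => ->; rewrite ?normrN normr1 mul1r.
  - have : v k @[k --> U] --> p by [].
    apply: cvg_trans; apply: near_eq_cvg.
    by apply: filterS2 T'E Tv => k -> ->.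
  - by move=> t _; exact: gP.
have end_p : gamma t @[t --> +oo] --> p.
  have -> : gamma = fun t : R => gamma (1 * t) by apply/funext => t; rewrite mul1r.
  apply: (ray 1 _ w (or_introl erefl) L_oo _ _ wp).
    apply: filterS tauP => k [/andP[? ?] _] t /andP[? ?].
    by rewrite mul1r; apply/andP; split; lra.
  by apply: nearW => k; rewrite mul1r.
have end_n : (gamma \o -%R) t @[t --> +oo] --> p.
  have -> : gamma \o -%R = fun t : R => gamma (-1 * t).
    by apply/funext => t; rewrite mulN1r.
  apply: (ray (-1) tau z (or_intror erefl) tau_oo _ _ zp).
    apply: filterS tauP => k [/andP[? ?] _] t /andP[? ?].
    by rewrite mulN1r; apply/andP; split; lra.
  by apply: nearW => k; rewrite mulN1r.
have end_n' : gamma t @[t --> -oo] --> p by apply/cvgNy_compNP.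
apply: (loopD1 (gamma := gamma)); split => //.
by rewrite (cluster_of_cvg _ end_p) ?(cluster_of_cvg _ end_n')//; exact: norm_hausdorff.
Qed.

End ultralimit.

(** The candidate is the ultralimit of [F] along one sequence [z]. If [F] stayed away from it
    arbitrarily close to [p], a second sequence [w] would have another ultralimit, against
    [boundary_limit_unique]. *)
Lemma image_limit_exists (p : 'rV[R[i]]_n) : closure D1 p ->
  exists l : 'rV[R[i]]_n, F x @[x --> within D1 (nbhs p)] --> l.
Proof.
move=> clp; have [Dp|nDp] := pselect (D1 p).
  have Fp : F x @[x --> p] --> F p := differentiable_continuous (dF Dp).
  by exists (F p); exact: cvg_within_filter.
have bp : boundary D1 p := conj clp (fun h => nDp (interior_subset h)).
have [eps [eps0 _ epsS]] := vanishing_sequence R.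
have H k : exists z, D1 z /\ nr (z - p) < eps k.
  by have [z [Dz zp]] := clp _ (nbhs_nr p (eps0 k)); exists z.
have [z zP] := choice H.
have [U [UU Uoo]] := exists_free_ultrafilter.
have to_p (v : nat -> 'rV[R[i]]_n) : (forall k, nr (v k - p) < eps k) ->
    v k @[k --> U] --> p.
  move=> vp; apply/cvg_nrP => e e0; apply: Uoo.
  by apply: filterS (epsS _ e0) => k; exact: lt_trans (vp k).
have lim (v : nat -> 'rV[R[i]]_n) : (forall k, D1 (v k)) ->
    exists2 q : 'rV[R[i]]_n, closure D2 q & F (v k) @[k --> U] --> q.
  move=> Dv; apply: (ultra_compact_cvg UU cD2); apply: nearW => k.
  exact: (subset_closure (FD (Dv k))).
have [q _ Fq] := lim z (fun k => (zP k).1).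
exists q; apply/cvg_nrP => e e0; apply: contrapT => ne.
have H' k : exists w, [/\ D1 w, nr (w - p) < eps k & e <= nr (F w - q)].
  apply: contrapT => nw; apply: ne; apply/nbhs_nrP; exists (eps k) => // w wp Dw.
  by rewrite ltNge; apply/negP => h; apply: nw; exists w.
have [w wP] := choice H'.
have Dw k : D1 (w k) by have [] := wP k.
have wp : w k @[k --> U] --> p by apply: to_p => k; have [] := wP k.
have zp : z k @[k --> U] --> p by apply: to_p => k; have [] := zP k.
have [q' _ Fq'] := lim w Dw.
have qq' := boundary_limit_unique UU Uoo bp (fun k => (zP k).1) Dw zp wp Fq Fq'.
move/cvg_nrP/(_ _ e0) : Fq'; rewrite -qq' => /filter_ex[k].
by have [_ _] := wP k; rewrite leNgt => /negP.
Qed.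

End boundary_extension.

(** Limits chosen point by point already form a continuous map: for [y] near [x], the value [E y] is
    approximated by some [F z] with [z] in [D] so close to [y] that it is still near [x]. *)
Lemma extension_by_limits {R : realType} {V W : normedModType R[i]} (D : set V)
    (F : V -> W) :
  (forall p, closure D p -> exists l : W, F x @[x --> within D (nbhs p)] --> l) ->
  exists E : V -> W, {within closure D, continuous E} /\ forall z, D z -> E z = F z.
Proof.
move=> H; have H' p : exists l, closure D p -> forall e : R, 0 < e ->
    exists2 r : R, 0 < r & forall x, nr (x - p) < r -> D x -> nr (F x - l) < e.
  have [/H[l /cvg_nrP Fl]|] := pselect (closure D p); last by exists 0.
  by exists l => _ e /Fl /nbhs_nrP[r r0 rP]; exists r.
have [E EP] := choice H'; exists E; split; last first.
  move=> z Dz; apply/esym/eqP; rewrite -subr_eq0; apply/eqP/nr_eq0/eqP.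
  rewrite eq_le nr_ge0 andbT; apply/ler_addgt0Pr => e e0; rewrite add0r.
  have [r r0 rP] := EP z (subset_closure Dz) _ e0.
  by apply/ltW/rP => //; rewrite subrr nr0.
apply/subspace_continuousP => x clx; apply/cvg_nrP => e e0.
have e2 : 0 < e / 2 by rewrite divr_gt0.
have [r r0 rP] := EP x clx _ e2.
apply/nbhs_nrP; exists (r / 2); first by rewrite divr_gt0.
move=> y yx cly; have [r' r'0 r'P] := EP y cly _ e2.
have s0 : 0 < Num.min r' (r / 2) by rewrite lt_min r'0 divr_gt0.
have [z [Dz]] := cly _ (nbhs_nr y s0); rewrite /= lt_min => /andP[z1 z2].
have h1 := r'P z z1 Dz.
have h2 : nr (F z - E x) < e / 2.
  by apply: rP => //; have := nr_triangle y z x; lra.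
by have := nr_triangle (F z) (E y) (E x); rewrite (nrB (E y) (F z)); lra.
Qed.

Lemma bounded_closure_compact {R : realType} {n : nat} (D : set 'rV[R[i]]_n) :
  bounded_set D -> compact (closure D).
Proof.
move=> [M [Mreal MP]].
have MD v : D v -> nr v <= nr M + 1.
  move=> Dv; rewrite -lecR -nrE; apply: (MP _ _ _ Dv).
  apply: (le_lt_trans (real_ler_norm Mreal)).
  by rewrite nrE ltcR ltrDl.
apply: (@nr_bounded_closed_compact _ _ _ (nr M + 1)); last exact: closed_closure.
move=> v clv; apply/ler_addgt0Pr => e e0.
have [w [Dw wv]] := clv _ (nbhs_nr v e0).
by have := MD w Dw; have := nrD (v - w) w; rewrite subrK (nrB v w); move: wv => /=; lra.
Qed.

Theorem proposition3p6 (R : realType) (n : nat)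
    (D1 D2 : set 'rV[R[i]]_n)
    (domD1 : is_domain D1) (domD2 : is_domain D2)
    (bndD1 : bounded_set D1) (bndD2 : bounded_set D2)
    (hypD1 : complete_hyperbolic D1) (hypD2 : complete_hyperbolic D2)
    (visD1 : visibility_property D1) (visD2 : visibility_property D2)
    (gromD1 : gromov_hyperbolic D1 (kobayashi_dist D1))
    (loopD1 : no_geodesic_loops D1)
    (F : 'rV[R[i]]_n -> 'rV[R[i]]_n) (bihF : biholomorphism D1 D2 F) :
  exists Fext : 'rV[R[i]]_n -> 'rV[R[i]]_n,
    {within closure D1, continuous Fext} /\
    (forall z, D1 z -> Fext z = F z).
Proof.
have [_ oD1 _] := domD1; have [_ oD2 _] := domD2.
have [dF [FD [G [dG GD FK GK]]]] := bihF.
apply: extension_by_limits => p.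
exact: (image_limit_exists oD1 oD2 (bounded_closure_compact bndD1)
  (bounded_closure_compact bndD2) hypD1 hypD2 visD1 visD2 loopD1 dF dG FD GD FK GK).
Qed.
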